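(* Let $k,m$ be functions of $n$, with $0\le k(n)\le n$ and $m(n)\in\mathbb{N}$, such that $k(n)=n-\omega(\log n)$ and $m(n)=\omega(\log n)$ (i.e. $(n-k(n))/\log n\to\infty$ and $m(n)/\log n\to\infty$). Then there exist efficient quantum cryptographic hash functions mapping $n$ bits to $m(n)$ qubits that are resilient against $k(n)$ bits of classical leakage.
   Context: A function $\delta(n)$ is negligible in $n$ (written $\mathrm{negl}(n)$) if for every $c>0$, $\delta(n)\le n^{-c}$ for all sufficiently large $n$. Logarithms are base 2. An $(n,m,\delta)$ quantum fingerprinting is a map $\phi:\{0,1\}^n\to\mathbb{C}^{2^m}$, $x\mapsto|\phi_x\rangle$, with unit vectors $|\phi_x\rangle$ and $\delta=\max_{x\neq x'}|\langle\phi_x|\phi_{x'}\rangle|$. Write $\phi_x=|\phi_x\rangle\langle\phi_x|$. A quantum cryptographic hash function is an $(n,m,\delta)$ quantum fingerprinting (understood as a family indexed by $n$) with $\delta=\mathrm{negl}(n)$. ''Efficient'' means efficiently computable: the state $|\phi_x\rangle$ can be prepared from $x$ by a quantum algorithm running in time polynomial in $n$ and $m$. Side information: a classical joint distribution $\eta_{XY}=\sum_{x,y}p_{x,y}|x\rangle\langle x|\otimes|y\rangle\langle y|$ with $X$ uniform on $\{0,1\}^n$ and $Y$ on a finite set. Guessing probability: $p_g(X|Y)_\eta=\sum_y\max_x p_{x,y}$; conditional min-entropy: $H_{\min}(X|Y)_\eta=-\log p_g(X|Y)_\eta$. ''$\ell$ bits of leakage'' means $n-H_{\min}(X|Y)_\eta\le\ell$.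 Forgery state: for each $y$ the adversary prepares an $m$-qubit density operator $\sigma_y$, giving $\rho_{XE}=\sum_{x,y}p_{x,y}|x\rangle\langle x|\otimes\sigma_y$. The verification scheme is $V=\sum_x|x\rangle\langle x|\otimes\phi_x$, and the passing probability is $\mathrm{Tr}(V\rho_{XE})$. $e_s^*(\ell)$ is the supremum of $\mathrm{Tr}(V\rho_{XE})$ over all forgery states obtained from $\ell$ bits of leakage. $\phi$ is resilient against $\ell$ bits of classical leakage if $e_s^*(\ell)=\mathrm{negl}(n)$. *)

(* Defs.v *)
From mathcomp Require Import all_boot all_order all_algebra.
From mathcomp Require Import complex mxtens.
From mathcomp Require Import all_classical all_reals all_analysis.

Set Implicit Arguments.
Unset Strict Implicit.
Unset Printing Implicit Defensive.

Import Order.TTheory GRing.Theory Num.Theory.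
Import numFieldNormedType.Exports.

Local Open Scope classical_set_scope.
Local Open Scope ring_scope.
Local Open Scope complex_scope.
Local Open Scope sesquilinear_scope.

Definition log2 (R : realType) (x : R) : R := ln x / ln 2.

Definition negligible (R : realType) (delta : nat -> R) : Prop :=
  forall c : R, 0 < c -> \forall n \near \oo, delta n <= n%:R `^ (- c).

(** ** Quantum fingerprinting *)

Definition dotc (R : realType) (d : nat) (u v : 'cV[R[i]]_d) : R[i] :=
  (u ^t* *m v) 0 0.

(* For n = 0 there is no pair x <> x', and the maximum is 0. *)
Definition max_overlap (R : realType) (n m : nat)
    (phi : n.-tuple bool -> 'cV[R[i]]_(2 ^ m)) : R :=
  \big[Num.max/0]_(p : n.-tuple bool * n.-tuple bool | p.1 != p.2)
    Normc.normc (dotc (phi p.1) (phi p.2)).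

Definition is_fingerprinting (R : realType) (n m : nat) (delta : R)
    (phi : n.-tuple bool -> 'cV[R[i]]_(2 ^ m)) : Prop :=
  (forall x, dotc (phi x) (phi x) = 1) /\ delta = max_overlap phi.

Definition is_quantum_hash (R : realType) (m : nat -> nat)
    (phi : forall n, n.-tuple bool -> 'cV[R[i]]_(2 ^ m n)) : Prop :=
  exists delta : nat -> R,
    (forall n, is_fingerprinting (delta n) (@phi n)) /\ negligible delta.

(** ** Classical side information and forgery *)

(* p x y is the joint probability of (X, Y) = (x, y), with X uniform. *)
Definition is_side_info (R : realType) (n : nat) (Y : finType)
    (p : n.-tuple bool -> Y -> R) : Prop :=
  (forall x y, 0 <= p x y) /\ (forall x, \sum_y p x y = (2 ^+ n)^-1).

Definition guessing_prob (R : realType) (n : nat) (Y : finType)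
    (p : n.-tuple bool -> Y -> R) : R :=
  \sum_y \big[Num.max/0]_x p x y.

Definition Hmin (R : realType) (n : nat) (Y : finType)
    (p : n.-tuple bool -> Y -> R) : R :=
  - log2 (guessing_prob p).

Definition has_leakage (R : realType) (n : nat) (Y : finType)
    (p : n.-tuple bool -> Y -> R) (l : R) : Prop :=
  n%:R - Hmin p <= l.

(* 0 <= z in R[i] means that z is real and nonnegative. *)
Definition is_density (R : realType) (d : nat) (sigma : 'M[R[i]]_d) : Prop :=
  [/\ sigma \is hermsymmx,
      forall v : 'cV[R[i]]_d, 0 <= dotc v (sigma *m v) & \tr sigma = 1].

(* The classical register X has one basis vector |x> per x in {0,1}^n. *)
Definition ket (R : realType) (n : nat) (x : n.-tuple bool)
    : 'cV[R[i]]_#|{: n.-tuple bool}| :=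
  delta_mx (enum_rank x) 0.

Definition proj (R : realType) (d : nat) (v : 'cV[R[i]]_d) : 'M[R[i]]_d :=
  v *m v ^t*.

Definition forgery_state (R : realType) (n m : nat) (Y : finType)
    (p : n.-tuple bool -> Y -> R) (sigma : Y -> 'M[R[i]]_(2 ^ m))
    : 'M[R[i]]_(#|{: n.-tuple bool}| * 2 ^ m) :=
  \sum_x \sum_y (p x y)%:C *: (proj (ket R x) *t sigma y).

Definition verification (R : realType) (n m : nat)
    (phi : n.-tuple bool -> 'cV[R[i]]_(2 ^ m))
    : 'M[R[i]]_(#|{: n.-tuple bool}| * 2 ^ m) :=
  \sum_x proj (ket R x) *t proj (phi x).

(* The trace is a real number here, hence the real part. *)
Definition passing_prob (R : realType) (n m : nat)
    (phi : n.-tuple bool -> 'cV[R[i]]_(2 ^ m))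
    (rho : 'M[R[i]]_(#|{: n.-tuple bool}| * 2 ^ m)) : R :=
  complex.Re (\tr (verification phi *m rho)).

Definition forgery_sup (R : realType) (n m : nat)
    (phi : n.-tuple bool -> 'cV[R[i]]_(2 ^ m)) (l : R) : R :=
  sup [set r : R | exists (Y : finType) (p : n.-tuple bool -> Y -> R)
                          (sigma : Y -> 'M[R[i]]_(2 ^ m)),
    [/\ is_side_info p, has_leakage p l, forall y, is_density (sigma y)
      & r = passing_prob phi (forgery_state p sigma)]].

Definition is_resilient (R : realType) (m : nat -> nat) (k : nat -> R)
    (phi : forall n, n.-tuple bool -> 'cV[R[i]]_(2 ^ m n)) : Prop :=
  negligible (fun n => forgery_sup (@phi n) (k n)).

(** ** Quantum circuits over the gate set {H, T, CNOT, Toffoli} *)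

Inductive gate : Type :=
  | GateH of nat
  | GateT of nat
  | GateCNOT of nat & nat            (* control, target *)
  | GateToffoli of nat & nat & nat.  (* control, control, target *)

Definition gate_wf (N : nat) (g : gate) : bool :=
  match g with
  | GateH q | GateT q => (q < N)%N
  | GateCNOT c t => uniq [:: c; t] && all (ltn^~ N) [:: c; t]
  | GateToffoli c d t => uniq [:: c; d; t] && all (ltn^~ N) [:: c; d; t]
  end.

(* Qubit q of the basis vector of index i of C^(2^N) is bit q of i, with qubit
   0 the least significant. *)
Definition qbit (i q : nat) : bool := odd (i %/ 2 ^ q).

Definition agree_off (N q i j : nat) : bool :=
  [forall r : 'I_N, (r != q :> nat) ==> (qbit i r == qbit j r)].

Definition gate_mx (R : realType) (N : nat) (g : gate) : 'M[R[i]]_(2 ^ N) :=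
  let s : R := (Num.sqrt 2)^-1 in
  match g with
  | GateH q => \matrix_(i, j)
      if agree_off N q i j then (-1) ^+ (qbit i q && qbit j q) * s%:C else 0
  | GateT q => \matrix_(i, j)
      if i == j then (s +i* s) ^+ (qbit i q) else 0
  | GateCNOT c t => \matrix_(i, j)
      (agree_off N t i j && (qbit i t == qbit j t (+) qbit j c))%:R
  | GateToffoli c d t => \matrix_(i, j)
      (agree_off N t i j
       && (qbit i t == qbit j t (+) (qbit j c && qbit j d)))%:R
  end.

(* |0...0>, the basis vector of index 0. *)
Definition zero_state (R : realType) (N : nat) : 'cV[R[i]]_(2 ^ N) :=
  \col_i (i == 0%N :> nat)%:R.

Definition run_circuit (R : realType) (N : nat) (C : seq gate)
    : 'cV[R[i]]_(2 ^ N) :=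
  foldl (fun psi g => gate_mx R N g *m psi) (zero_state R N) C.

(* |phi> (x) |0...0> with a ancillas: the ancillas are the a most significant
   qubits, so they are all 0 on the indices below 2^m. *)
Definition with_ancillas (R : realType) (m a : nat) (phi : 'cV[R[i]]_(2 ^ m))
    : 'cV[R[i]]_(2 ^ (m + a)) :=
  \col_i if insub (i : nat) is Some j then phi j 0 else 0.

Definition prepares (R : realType) (m a : nat) (C : seq gate)
    (phi : 'cV[R[i]]_(2 ^ m)) : Prop :=
  all (gate_wf (m + a)) C /\ run_circuit R (m + a) C = with_ancillas a phi.

(** ** Quantum algorithms

    A quantum algorithm is a program for a classical random-access machine that
    also issues quantum gates, on qubits whose addresses it computes.  The
    memory is a collection of unbounded arrays, a program being able to name
    only finitely many of them.  Time is the number of executed instructions;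
    since the only arithmetic operations are addition and truncated
    subtraction, words have O(time) bits and running times agree with those
    of Turing machines up to a polynomial. *)

Inductive expr : Type :=
  | Const of nat
  | Get of nat & expr   (* Get a e is the entry of array a at address e *)
  | Add of expr & expr
  | Sub of expr & expr.

Inductive gate_instr : Type :=
  | ApplyH of expr
  | ApplyT of expr
  | ApplyCNOT of expr & expr
  | ApplyToffoli of expr & expr & expr.

Inductive prog : Type :=
  | Skip
  | Put of nat & expr & expr   (* Put a e v stores v in array a at address e *)
  | Apply of gate_instr
  | Seq of prog & prog
  | If of expr & prog & prog   (* conditions hold when nonzero *)
  | While of expr & prog.

Definition store : Type := nat -> nat -> nat.

Fixpoint eval (s : store) (e : expr) : nat :=
  match e with
  | Const c => c
  | Get a e => s a (eval s e)
  | Add e f => (eval s e + eval s f)%N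
  | Sub e f => (eval s e - eval s f)%N
  end.

Definition eval_gate (s : store) (g : gate_instr) : gate :=
  match g with
  | ApplyH q => GateH (eval s q)
  | ApplyT q => GateT (eval s q)
  | ApplyCNOT c t => GateCNOT (eval s c) (eval s t)
  | ApplyToffoli c d t => GateToffoli (eval s c) (eval s d) (eval s t)
  end.

Definition put (s : store) (a i v : nat) : store :=
  fun b j => if (b == a) && (j == i) then v else s b j.

(* exec P s t s' C: started in s, P halts in s' after t steps, having applied
   the gates C in this order. *)
Inductive exec : prog -> store -> nat -> store -> seq gate -> Prop :=
  | exec_skip s : exec Skip s 1 s [::]
  | exec_put a e v s :
      exec (Put a e v) s 1 (put s a (eval s e) (eval s v)) [::]
  | exec_apply g s : exec (Apply g) s 1 s [:: eval_gate s g]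
  | exec_seq P Q s s1 s2 t1 t2 C1 C2 :
      exec P s t1 s1 C1 -> exec Q s1 t2 s2 C2 ->
      exec (Seq P Q) s (t1 + t2) s2 (C1 ++ C2)
  | exec_if e P Q s s1 t C :
      exec (if eval s e != 0%N then P else Q) s t s1 C ->
      exec (If e P Q) s t.+1 s1 C
  | exec_while_stop e P s : eval s e = 0%N -> exec (While e P) s 1 s [::]
  | exec_while_loop e P s s1 s2 t1 t2 C1 C2 :
      eval s e <> 0%N ->
      exec P s t1 s1 C1 -> exec (While e P) s1 t2 s2 C2 ->
      exec (While e P) s (t1 + t2).+1 s2 (C1 ++ C2).

(* The input (x, n, m): the bits of x in array 0, n and m at address 0 of
   arrays 1 and 2, and 0 elsewhere. *)
Definition input_store (n m : nat) (x : n.-tuple bool) : store :=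
  fun a i => match a, i with
             | 0, _ => nth false x i
             | 1, 0 => n
             | 2, 0 => m
             | _, _ => 0
             end%N.

(* One program serves all n and x; time and number of qubits are polynomially
   bounded in n and m. *)
Definition is_efficient (R : realType) (m : nat -> nat)
    (phi : forall n, n.-tuple bool -> 'cV[R[i]]_(2 ^ m n)) : Prop :=
  exists (P : prog) (c : nat), forall (n : nat) (x : n.-tuple bool),
  exists (t : nat) (s : store) (C : seq gate) (a : nat),
    [/\ exec P (input_store (m n) x) t s C,
        (t <= c * (n + m n).+1 ^ c)%N,
        (m n + a <= c * (n + m n).+1 ^ c)%N
      & prepares a C (phi n x)].

(* Main.v *)
Require Import Defs.
From mathcomp Require Import all_boot all_order all_algebra.
From mathcomp Require Import complex mxtens.
From mathcomp Require Import all_classical all_reals all_analysis.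
From mathcomp Require Import zify ring lra.

(** Every fingerprinting with overlap [delta] passes forgeries with probability
    at most [2 ^ (k - n) + delta]: conditionally on [y], the adversary gains at
    most [max_x p x y + delta * P y], since the operators [|phi_x><phi_x|] are
    almost orthogonal.  So a negligible overlap suffices.

    Let [r] be about [log n], let [q = 2 ^ (2 r) >= n ^ 2] and let [p] be the
    least prime above [q].  Hash [x] with a seed [a < q] by evaluating at [a],
    modulo [p], the polynomial with coefficients [x]: two inputs collide for at
    most [n] seeds.  The state is the uniform superposition of
    [|a_1 .. a_t> |h_x(a_1) .. h_x(a_t)>], where [t] is as large as [m] qubits
    allow; its overlaps are at most [(n / q) ^ t <= n ^ - t], and [t] tends to
    infinity because [m] grows faster than [log n].

    As [q] and [p] are polynomial in [n], a classical program can find [p] by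
    trial division, tabulate the hash, and implement the table by one
    multiply-controlled NOT per seed and output bit. *)

Set Implicit Arguments.
Unset Strict Implicit.
Unset Printing Implicit Defensive.

Import Order.TTheory GRing.Theory Num.Theory.
Import numFieldNormedType.Exports.

(** * A prime between Q and 8 Q ^ 2 *)

(** Two demands shape the construction: the state is prepared exactly, and nothing is random. Exact
    uniform superpositions made of Hadamard gates need a number of seeds that is a power of two,
    while counting collisions by roots needs a field; so the seeds fill only an initial segment of
    the residues modulo [p]. Determinism speaks against a single block as wide as [m] allows: brute
    force finds its prime and tabulates its hash only in time exponential in that width. Blocks of
    logarithmic width stay within reach of exhaustive search, and what they lose in strength is
    regained by taking [t] independent seeds, over which overlaps multiply.

    The prime must be polynomial in [q] for a second reason besides time: a residue has to fit into
    a logarithmic number of qubits, or [t] would not tend to infinity. The bound [8 * q ^ 2] comes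
    from a crude form of Erdős's argument on the central binomial coefficient. *)

Lemma leq_expn2_central_bin M : 2 ^ M <= 'C(M.*2, M).
Proof.
elim: M => [|M IH]; first by rewrite bin0.
(* Pascal's rule gives two summands that are equal by symmetry, and each is at least ['C(M.*2, M)];
   so every step at least doubles the coefficient. *)
have e : 'C(M.+1.*2, M.+1) = ('C(M.*2.+1, M)).*2.
  rewrite doubleS binS -[RHS]addnn; congr (_ + _).
  rewrite -[RHS]bin_sub; last by lia.
  by congr 'C(_, _); lia.
rewrite e expnS mul2n leq_double; apply: leq_trans IH _.
by case: M {e} => [|M] //; rewrite binS leq_addr.
Qed.

(** By Legendre's formula the exponent is the sum over [k] of [M.*2 %/ p ^ k] minus twice
    [M %/ p ^ k]. Each term is at most 1, and the terms with [p ^ k > M.*2] vanish. *)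
Lemma pfactor_central_bin_leq M p : prime p -> 0 < M ->
  p ^ logn p 'C(M.*2, M) <= M.*2.
Proof.
move=> pp M0.
have p1 := prime_gt1 pp.
set T := trunc_log p M.*2.
have leT : logn p 'C(M.*2, M) <= T.
  have := bin_fact (leq_addl M M); rewrite addnn => e.
  have := congr1 (logn p) e.
  have -> : M.*2 - M = M by lia.
  rewrite !lognM ?muln_gt0 ?fact_gt0 ?bin_gt0 //; try lia.
  rewrite !logn_fact //.
  (* Legendre's sums for [M.*2] and [M] have different lengths; both are brought to the range up to
     [T], outside which the quotients are 0. *)
  have cut m : m <= M.*2 -> \sum_(1 <= k < m.+1) m %/ p ^ k =
      \sum_(1 <= k < T.+1) m %/ p ^ k.
    move=> lem.
    have zero a b : T <= a -> \sum_(a.+1 <= k < b) m %/ p ^ k = 0.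
      move=> Ta; rewrite big_nat big1 // => k /andP[k1 k2].
      apply: divn_small; apply: leq_ltn_trans lem _.
      by apply: leq_trans (trunc_log_ltn _ p1) _; rewrite leq_pexp2l //; lia.
    have zero' a b : m <= a -> \sum_(a.+1 <= k < b) m %/ p ^ k = 0.
      move=> Ta; rewrite big_nat big1 // => k /andP[k1 k2].
      apply: divn_small; apply: leq_ltn_trans (ltn_expl _ p1).
      by lia.
    case: (leqP m T) => mT.
      by rewrite [RHS](big_cat_nat _ (n := m.+1)) //= (zero' m) //= addn0.
    by rewrite (big_cat_nat _ (n := T.+1)) //= ?(zero T) ?addn0 //; lia.
  rewrite !cut //; last by lia.
  rewrite -big_split /= => h.
  have : \sum_(1 <= k < T.+1) M.*2 %/ p ^ k <=
      \sum_(1 <= k < T.+1) (M %/ p ^ k + M %/ p ^ k + 1).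
    apply: leq_sum => k _.
    have d0 : 0 < p ^ k by rewrite expn_gt0; lia.
    rewrite -ltnS ltn_divLR //.
    have := ltn_ceil M d0; nia.
  rewrite big_split /= sum_nat_const_nat; lia.
apply: leq_trans (trunc_logP p1 _); last by lia.
by rewrite leq_pexp2l //; lia.
Qed.

(** Otherwise, with [M = 4 * Q ^ 2], all prime divisors of ['C(M.*2, M)] are at most [Q] and each
    contributes at most [M.*2], whence [2 ^ M <= M.*2 ^ Q]. As [M.*2] is [2 ^ (2 * R + 3)], this
    means [4 * Q <= 2 * R + 3], against [R < Q]. *)
Lemma prime_between R : exists2 p, prime p & 2 ^ R < p <= 8 * (2 ^ R) ^ 2.
Proof.
pose Q := 2 ^ R; pose M := 4 * Q ^ 2.
have Q0 : 0 < Q by rewrite expn_gt0.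
have M0 : 0 < M by rewrite /M; nia.
case: (boolP (has (fun p => prime p && (Q < p)) (iota 0 M.*2.+1))) => [|noP].
  case/hasP=> p; rewrite mem_iota => /andP[_ lep] /andP[pp ltp].
  by exists p => //; rewrite ltp /= -/Q; rewrite /M in lep; lia.
exfalso.
have small p : prime p -> p <= M.*2 -> p <= Q.
  move=> pp lep; rewrite leqNgt; apply/negP => ltp.
  move/hasP: noP; apply; exists p; rewrite ?mem_iota ?pp //=; lia.
have B0 : 0 < 'C(M.*2, M) by rewrite bin_gt0; lia.
have leB : 'C(M.*2, M) <= M.*2 ^ Q.
  rewrite {1}(prod_prime_decomp B0) prime_decompE big_map /=.
  have cnt : size (primes 'C(M.*2, M)) <= Q.
    rewrite -[leqRHS](size_iota 1 Q); apply: uniq_leq_size (primes_uniq _) _.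
    move=> p; rewrite mem_primes B0 mem_iota /= => /andP[pp dvd].
    rewrite prime_gt0 //= add1n ltnS; apply: small => //.
    apply: leq_trans (pfactor_central_bin_leq pp M0).
    rewrite -{1}(expn1 p) leq_pexp2l ?(prime_gt0 pp) //.
    by rewrite logn_gt0 mem_primes pp B0.
  apply: leq_trans (_ : \prod_(p <- primes 'C(M.*2, M)) M.*2 <= _).
    rewrite !big_seq; apply: leq_prod => p.
    by rewrite mem_primes => /andP[pp _]; apply: pfactor_central_bin_leq.
  rewrite big_const_seq iter_muln_1 count_predT leq_pexp2l //; lia.
have := leq_trans (leq_expn2_central_bin M) leB.
have -> : M.*2 = 2 ^ (R + R + 3) by rewrite /M /Q !expnD; lia.
have -> : M = 4 * Q * Q by rewrite /M; lia.
rewrite -expnM leq_exp2l // leq_pmul2r // leqNgt => /negP; apply.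
by have := ltn_expl R (ltnSn 1); rewrite -/Q; lia.
Qed.

(** * Polynomial hashing *)

Fact prime_above_ex Q : exists p, prime p && (Q < p).
Proof. by have [p ltp pp] := prime_above Q; exists p; rewrite pp. Qed.

Definition next_prime (Q : nat) : nat := ex_minn (prime_above_ex Q).

Lemma next_prime_prime Q : prime (next_prime Q).
Proof. by rewrite /next_prime; case: ex_minnP => p /andP[]. Qed.

Lemma next_prime_gt Q : Q < next_prime Q.
Proof. by rewrite /next_prime; case: ex_minnP => p /andP[]. Qed.

Lemma next_prime_min Q p : prime p -> Q < p -> next_prime Q <= p.
Proof.
move=> pp ltp; rewrite /next_prime; case: ex_minnP => q _; apply.
by rewrite pp.
Qed.

Lemma next_prime_leq R : next_prime (2 ^ R) <= 8 * (2 ^ R) ^ 2.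
Proof.
have [p pp /andP[ltp lep]] := prime_between R.
exact: leq_trans (next_prime_min pp ltp) lep.
Qed.

Lemma next_prime_ltn R : next_prime (2 ^ R) < 2 ^ (R + R + 4).
Proof.
apply: leq_ltn_trans (next_prime_leq R) _.
by rewrite !expnD; have : 0 < 2 ^ R by [rewrite expn_gt0]; nia.
Qed.

(** Horner's rule. The head of [x] becomes the leading coefficient, which is why [rev x] appears
    when this is compared with a polynomial. *)
Definition poly_hash (p : nat) (x : seq bool) (a : nat) : nat :=
  foldl (fun h (b : bool) => (b + a * h) %% p) 0 x.

Lemma poly_hash_ltn p x a : 0 < p -> poly_hash p x a < p.
Proof.
move=> p0; elim/last_ind: x => [|x b _] //.
by rewrite /poly_hash foldl_rcons ltn_pmod.
Qed.

Lemma poly_hash_horner p x a : prime p ->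
  ((poly_hash p x a)%:R = (Poly [seq (nat_of_bool b)%:R | b <- rev x]).[a%:R] :> 'F_p)%R.
Proof.
move=> pp; elim/last_ind: x => [|x b IH]; first by rewrite /= horner0.
rewrite rev_rcons /= horner_cons -IH /poly_hash foldl_rcons.
by rewrite (Fp_nat_mod pp) natrD natrM addrC mulrC.
Qed.

(** A collision is a root of the difference of two polynomials, which is nonzero of degree less than
    [size x]; [Q <= p] keeps the seeds distinct in ['F_p]. *)
Lemma poly_hash_collisions p Q x y : prime p -> Q <= p ->
  size x = size y -> x <> y ->
  count (fun a => poly_hash p x a == poly_hash p y a) (iota 0 Q) <= size x.
Proof.
move=> pp leQ szxy nexy.
pose P z : {poly 'F_p} := Poly [seq (nat_of_bool b)%:R%R | b <- rev z].
have inj01 : injective (fun b : bool => (nat_of_bool b)%:R%R : 'F_p).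
  by case=> [] [] //= /eqP; rewrite ?oner_eq0 // eq_sym oner_eq0.
have Pcoef z i : ((P z)`_i)%R = (nat_of_bool (nth false (rev z) i))%:R%R.
  rewrite coef_Poly; case: (ltnP i (size (rev z))) => h.
    by rewrite (nth_map false).
  by rewrite !nth_default ?size_map.
have nz : (P x - P y != 0)%R.
  apply/eqP => /subr0_eq e; apply: nexy; apply: (can_inj revK).
  apply: (@eq_from_nth _ false) => [|i _]; first by rewrite !size_rev.
  by apply: inj01; rewrite -!Pcoef e.
have szP z : size (P z) <= size z.
  by apply: leq_trans (size_Poly _) _; rewrite size_map size_rev.
rewrite -size_filter -(size_map (fun a => a%:R%R : 'F_p)).
have h := max_poly_roots nz (rs := [seq (a%:R%R : 'F_p) | a <- iota 0 Q &
  poly_hash p x a == poly_hash p y a]).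
apply: ltnW; apply: leq_trans (h _ _) _.
- apply/allP => z /mapP[a]; rewrite mem_filter => /andP[/eqP e _] {z}->.
  by rewrite rootE hornerD hornerN -!poly_hash_horner // e subrr.
- rewrite map_inj_in_uniq ?filter_uniq ?iota_uniq // => a b.
  rewrite !mem_filter !mem_iota !add0n /= => /andP[_ la] /andP[_ lb].
  move=> /(congr1 val); rewrite /= !val_Fp_nat // !modn_small //;
    by [exact: leq_trans leQ].
apply: leq_trans (size_polyD _ _) _; rewrite size_polyN geq_max szP /=.
by rewrite szxy szP.
Qed.

Definition block (Q j A : nat) : nat := (A %/ Q ^ j) %% Q.

(** The [t] digits in base [Q] are independent. The induction splits off the leading digit [i],
    writing the number as [i * Q ^ t + A]. *)
Lemma count_blocks (Q t : nat) (E : pred nat) : 0 < Q ->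
  count (fun A => all (fun j => E (block Q j A)) (iota 0 t)) (iota 0 (Q ^ t)) =
  count E (iota 0 Q) ^ t.
Proof.
move=> Q0; elim: t => [|t IH] //.
have sumE (P : pred nat) n : count P (iota 0 n) = \sum_(0 <= i < n) P i.
  by rewrite -sum1_count big_mkcond /index_iota subn0; apply: eq_bigr => i _; case: P.
rewrite (@eq_count _ _ (fun A => E (block Q t A) &&
    all (fun j => E (block Q j A)) (iota 0 t))); last first.
  by move=> A; rewrite -(addn1 t) iotaD all_cat /= andbT andbC.
rewrite !expnS sumE big_nat_mul -IH [in RHS]sumE big_distrl /=.
rewrite big_nat [RHS]big_nat; apply: eq_bigr => i /= ltiQ.
rewrite sumE -[X in \sum_(X <= _ < _) _]add0n mulSn big_addn addnK.
rewrite big_distrr /= big_nat [RHS]big_nat; apply: eq_bigr => A /= ltA.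
have Qt0 : 0 < Q ^ t by rewrite expn_gt0 Q0.
rewrite -mulnb [A + _]addnC; congr (nat_of_bool _ * nat_of_bool _).
  congr E; rewrite /block divnMDl // divn_small // addn0 modn_small //.
apply: eq_in_all => j; rewrite mem_iota add0n => /andP[_ ltj].
rewrite /block; congr E.
have -> : i * Q ^ t = i * Q ^ (t - j.+1) * Q * Q ^ j.
  rewrite -mulnA -expnS -mulnA -expnD; congr (_ * Q ^ _); lia.
by rewrite divnMDl ?expn_gt0 ?Q0 // modnMDl.
Qed.

(** * Circuits *)

Lemma qbitE i q : qbit i q = odd (i %/ 2 ^ q). Proof. by []. Qed.

Lemma qbit0 i : qbit i 0 = odd i.
Proof. by rewrite /qbit divn1. Qed.

Lemma qbitS i q : qbit i q.+1 = qbit i./2 q.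
Proof. by rewrite /qbit expnS divnMA divn2. Qed.

Lemma qbit_small i q : i < 2 ^ q -> qbit i q = false.
Proof. by move=> lt; rewrite /qbit divn_small. Qed.

Lemma qbit_inj N i j : i < 2 ^ N -> j < 2 ^ N ->
  (forall r, r < N -> qbit i r = qbit j r) -> i = j.
Proof.
elim: N i j => [|N IH] i j; first by rewrite !ltnS !leqn0 => /eqP-> /eqP->.
rewrite !expnS !mul2n => lti ltj e.
rewrite -(odd_double_half i) -(odd_double_half j) -!qbit0 e //; congr (_ + _.*2).
by apply: IH => [||r ltr]; rewrite -?qbitS ?e //; lia.
Qed.

Lemma qbit_block R j A i : i < R -> qbit (block (2 ^ R) j A) i = qbit A (R * j + i).
Proof.
move=> lti; rewrite /block -expnM /qbit expnD divnMA.
set B := A %/ _; rewrite [B in RHS](divn_eq B (2 ^ R)).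
have -> : B %/ 2 ^ R * 2 ^ R = (B %/ 2 ^ R * 2 ^ (R - i.+1)).*2 * 2 ^ i.
  rewrite -[_.*2]muln2 -!mulnA -expnS -expnD; congr (_ * 2 ^ _); lia.
by rewrite divnMDl ?expn_gt0 // oddD odd_double.
Qed.

Fixpoint of_bits (N : nat) (b : nat -> bool) : nat :=
  if N is N'.+1 then b 0 + (of_bits N' (b \o S)).*2 else 0.

Lemma of_bits_ltn N b : of_bits N b < 2 ^ N.
Proof.
by elim: N b => //= N IH b; have := IH (b \o S); rewrite expnS; case: (b 0); lia.
Qed.

Lemma qbit_of_bits N b r : r < N -> qbit (of_bits N b) r = b r.
Proof.
elim: N b r => //= N IH b [|r] ltr.
  by rewrite qbit0 oddD odd_double addbF; case: (b 0).
by rewrite qbitS half_bit_double IH.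
Qed.

Definition bits_ord (N : nat) (b : nat -> bool) : 'I_(2 ^ N) :=
  Ordinal (of_bits_ltn N b).

Lemma eq_bits_ord N (i : 'I_(2 ^ N)) b :
  (i == bits_ord N b) = [forall r : 'I_N, qbit i r == b r].
Proof.
apply/eqP/forallP => [-> r|e]; first by rewrite qbit_of_bits.
apply/val_inj/(@qbit_inj N); rewrite ?of_bits_ltn ?ltn_ord // => r ltr.
by rewrite qbit_of_bits //; apply/eqP: (e (Ordinal ltr)).
Qed.

Definition upd (b : nat -> bool) (q : nat) (v : bool) : nat -> bool :=
  fun r => if r == q then v else b r.

(** The common core of the matrices of H, CNOT and Toffoli: a matrix entry becomes the indicator of
    one updated basis vector. *)
Lemma agree_off_bits N q (i : 'I_(2 ^ N)) b v : q < N ->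
  agree_off N q i (bits_ord N b) && (qbit i q == v) = (i == bits_ord N (upd b q v)).
Proof.
move=> ltq; rewrite eq_bits_ord; apply/andP/forallP => [[/forallP e /eqP ev] r|e].
  have := e r; rewrite /upd; case: eqP => [->|_] /=; first by rewrite ev.
  by rewrite qbit_of_bits.
split; last by have := e (Ordinal ltq); rewrite /upd /= eqxx.
apply/forallP => r; apply/implyP => neq; have := e r.
by rewrite /upd (negPf neq) qbit_of_bits.
Qed.

Section Circuits.
Variable R : realType.
Local Open Scope ring_scope.
Local Open Scope complex_scope.

(** Naming basis vectors by functions on all of [nat], read only below [N], turns gates into calls
    of [upd] and lets one function name a vector with or without ancillas. *)
Definition bvec (N : nat) (b : nat -> bool) : 'cV[R[i]]_(2 ^ N) :=
  delta_mx (bits_ord N b) 0.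

Lemma eq_bvec N b b' : (forall r, (r < N)%N -> b r = b' r) -> bvec N b = bvec N b'.
Proof.
move=> e; congr delta_mx; apply/eqP; rewrite eq_bits_ord.
by apply/forallP => r; rewrite qbit_of_bits // e.
Qed.

Lemma mul_bvec N (M : 'M[R[i]]_(2 ^ N)) b i :
  (M *m bvec N b) i 0 = M i (bits_ord N b).
Proof. by rewrite /bvec -colE mxE. Qed.

Lemma bvecE N b i : bvec N b i 0 = (i == bits_ord N b)%:R.
Proof. by rewrite mxE eqxx andbT. Qed.

Lemma zero_stateE N : zero_state R N = bvec N (fun=> false).
Proof.
apply/colP => i; rewrite bvecE mxE; congr (nat_of_bool _)%:R.
apply/eqP/eqP => [e|->] /=.
  apply/eqP; rewrite eq_bits_ord; apply/forallP => r.
  by rewrite e qbit_small // expn_gt0.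
apply: (@qbit_inj N); rewrite ?of_bits_ltn ?expn_gt0 // => r ltr.
by rewrite qbit_of_bits // qbit_small // expn_gt0.
Qed.

Lemma cnot_bvec N c t b : (c < N)%N -> (t < N)%N ->
  gate_mx R N (GateCNOT c t) *m bvec N b = bvec N (upd b t (b t (+) b c)).
Proof.
move=> ltc ltt; apply/colP => i; rewrite mul_bvec bvecE mxE !qbit_of_bits //.
by rewrite agree_off_bits.
Qed.

Lemma toffoli_bvec N c d t b : (c < N)%N -> (d < N)%N -> (t < N)%N ->
  gate_mx R N (GateToffoli c d t) *m bvec N b =
  bvec N (upd b t (b t (+) (b c && b d))).
Proof.
move=> ltc ltd ltt; apply/colP => i; rewrite mul_bvec bvecE mxE !qbit_of_bits //.
by rewrite agree_off_bits.
Qed.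

Let s : R[i] := ((Num.sqrt 2)^-1 : R)%:C.

Lemma hadamard_bvec N q b : (q < N)%N -> gate_mx R N (GateH q) *m bvec N b =
  s *: (bvec N (upd b q false) + (-1) ^+ b q *: bvec N (upd b q true)).
Proof.
move=> ltq; apply/colP => i; rewrite mul_bvec !mxE qbit_of_bits // !eqxx !andbT.
rewrite -!agree_off_bits //; case: (agree_off _ _ _ _) => /=; last first.
  by rewrite mulr0 addr0 mulr0.
by case: (qbit i q); rewrite -/s /= ?expr0 ?(mulr0, mulr1, add0r, addr0) 1?mulrC ?mulr1.
Qed.

Lemma tgate_bvec N q b : (q < N)%N -> gate_mx R N (GateT q) *m bvec N b =
  ((Num.sqrt 2)^-1 +i* (Num.sqrt 2)^-1) ^+ b q *: bvec N b.
Proof.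
move=> ltq; apply/colP => i; rewrite mul_bvec !mxE eqxx andbT.
by case: eqP => [->|_] /=; rewrite ?qbit_of_bits ?mulr1 ?mulr0.
Qed.

Lemma sqr_s : s ^+ 2 = 2^-1.
Proof.
rewrite /s -rmorphXn /= exprVn sqr_sqrtr ?ler0n // fmorphV; congr (_^-1).
exact: rmorph_nat.
Qed.

Lemma eighth_root_pow4 :
  ((Num.sqrt 2)^-1 +i* (Num.sqrt 2)^-1 : R[i]) ^+ 4 = -1.
Proof.
have -> : (Num.sqrt 2)^-1 +i* (Num.sqrt 2)^-1 = s * (1 +i* 1) :> R[i].
  by rewrite /s; apply/eqP; rewrite eq_complex /= !mul0r !mulr1 subr0 addr0 !eqxx.
have e : (1 +i* 1 : R[i]) ^+ 2 = 2 * 'i.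
  rewrite expr2 mulr_natl mulr2n; apply/eqP; rewrite eq_complex /=.
  by rewrite !mulr1 subrr addr0 !eqxx.
rewrite (exprM _ 2 2) (exprMn 2 s) sqr_s e mulrA mulVf ?pnatr_eq0 // mul1r.
exact: sqr_i.
Qed.

Definition apply_gates N (C : seq gate) (psi : 'cV[R[i]]_(2 ^ N)) :=
  foldl (fun psi g => gate_mx R N g *m psi) psi C.

Lemma apply_gates_cat N C C' (psi : 'cV[R[i]]_(2 ^ N)) :
  apply_gates (C ++ C') psi = apply_gates C' (apply_gates C psi).
Proof. exact: foldl_cat. Qed.

Lemma apply_gates_scale N C c (psi : 'cV[R[i]]_(2 ^ N)) :
  apply_gates C (c *: psi) = c *: apply_gates C psi.
Proof. by elim: C psi => //= g C IH psi; rewrite -scalemxAr IH. Qed.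

Lemma apply_gates_sum N C I (r : seq I) (F : I -> 'cV[R[i]]_(2 ^ N)) :
  apply_gates C (\sum_(i <- r) F i) = \sum_(i <- r) apply_gates C (F i).
Proof.
elim: C F => //= g C IH F.
by rewrite -IH mulmx_sumr.
Qed.

(** NOT is HZH, and Z is the fourth power of T since the phase of T is a primitive eighth root of
    unity. *)
Definition flip (q : nat) : seq gate :=
  [:: GateH q; GateT q; GateT q; GateT q; GateT q; GateH q].

Lemma flip_bvec N q b : (q < N)%N ->
  apply_gates (flip q) (bvec N b) = bvec N (upd b q (~~ b q)).
Proof.
move=> ltq; have uu c v w : upd (upd c q v) q w =1 upd c q w.
  by move=> r; rewrite /upd; case: eqP.
have uq c v : upd c q v q = v by rewrite /upd eqxx.
rewrite /= hadamard_bvec //.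
rewrite -!scalemxAr !mulmxDr -!scalemxAr !tgate_bvec // !uq expr0 expr1 !scale1r.
rewrite -!scalemxAr !tgate_bvec // !uq expr0 expr1 !scale1r.
rewrite -!scalemxAr !tgate_bvec // !uq expr0 expr1 !scale1r.
rewrite -!scalemxAr !tgate_bvec // !uq expr0 expr1 !scale1r.
rewrite -!scalemxAr !hadamard_bvec // !uq expr0 expr1 !scale1r.
have euu v w : bvec N (upd (upd b q v) q w) = bvec N (upd b q w).
  by apply: eq_bvec => r _; rewrite uu.
rewrite !euu !scalerA; set t := _ +i* _.
have -> : (-1) ^+ b q * t * t * t * t = - (-1) ^+ b q :> R[i].
  by rewrite -!mulrA -[t * (t * (t * t))]/(t ^+ 4) eighth_root_pow4 mulrN1.
rewrite scaleN1r [_ * s]mulrC -scalerA -scalerDr scalerA -expr2 sqr_s.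
set e0 := bvec N (upd b q false); set e1 := bvec N (upd b q true).
have half (v : 'cV[R[i]]_(2 ^ N)) : 2^-1 *: (v + v) = v.
  by rewrite -{1 2}(scale1r v) -scalerDl scalerA mulVf ?pnatr_eq0 // scale1r.
case: (b q) => /=.
  by rewrite expr1 opprK scale1r addrACA subrr addr0 half.
by rewrite expr0 scaleN1r opprB addrC subrKA half.
Qed.

Lemma hadamard_layer N S : (S <= N)%N ->
  apply_gates (map GateH (iota 0 S)) (zero_state R N) =
  s ^+ S *: \sum_(A <- iota 0 (2 ^ S)) bvec N (qbit A).
Proof.
elim: S => [|S IH] ltS.
  rewrite expr0 scale1r big_seq1 zero_stateE; apply: eq_bvec => r _.
  by rewrite qbit_small // expn_gt0.
have -> : iota 0 S.+1 = iota 0 S ++ [:: S] by rewrite -addn1 iotaD.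
rewrite map_cat apply_gates_cat IH 1?ltnW // apply_gates_scale.
rewrite apply_gates_sum exprSr -scalerA; congr (_ *: _).
(* The new qubit [S] is the leading bit: the two terms made by its Hadamard gate are the indices [A]
   and [2 ^ S + A]. *)
have -> : iota 0 (2 ^ S.+1) = iota 0 (2 ^ S) ++ map (addn (2 ^ S)) (iota 0 (2 ^ S)).
  by rewrite expnS mul2n -addnn iotaD add0n -iotaDl addn0.
rewrite big_cat big_map /= -big_split scaler_sumr big_seq [RHS]big_seq /=.
apply: eq_bigr => A; rewrite mem_iota => /andP[_ ltA].
rewrite hadamard_bvec // qbit_small // expr0 scale1r; congr (_ *: (_ + _)).
  by apply: eq_bvec => r _; rewrite /upd; case: eqP => // ->; rewrite qbit_small.
apply: eq_bvec => r _; rewrite /upd; case: (ltngtP r S) => [ltr|gtr|->].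
- rewrite /qbit -(subnK ltr) expnD expnS mulnA divnMDl ?expn_gt0 //.
  by rewrite oddD muln2 odd_double.
- rewrite !qbit_small //; last by apply: leq_trans ltA _; rewrite leq_exp2l // ltnW.
  apply: leq_trans (_ : _ <= 2 ^ S.+1)%N _; last by rewrite leq_exp2l.
  by rewrite expnS; lia.
by rewrite /qbit -{1}(mul1n (2 ^ S)%N) divnMDl ?expn_gt0 // divn_small.
Qed.
End Circuits.

(** * Reversible table lookup on basis vectors *)

Definition maps (R : realType) (N : nat) (C : seq gate) (b b' : nat -> bool) : Prop :=
  all (gate_wf N) C /\ apply_gates C (bvec R N b) = bvec R N b'.

(** The Toffoli gate adds the conjunction of ancilla [anc + i] with the seed bit. Where [a] has a 0,
    adding the ancilla once more turns this into the conjunction with the negated bit, so no seed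
    bit has to be flipped. *)
Definition chain_step (anc base a i : nat) : seq gate :=
  GateToffoli (anc + i) (base + i) (anc + i.+1) ::
  (if qbit a i then [::] else [:: GateCNOT (anc + i) (anc + i.+1)]).

Definition copy_step (src out h l : nat) : seq gate :=
  if qbit h l then [:: GateCNOT src (out + l)] else [::].

(* The ancilla [anc + i] holds the conjunction of the first [i] tests of the bits
   of [a]; the last pass uncomputes the ancillas, each step being an involution. *)
Definition lookup (k w anc base out a h : nat) : seq gate :=
  flatten [seq chain_step anc base a i | i <- iota 0 k] ++
  flatten [seq copy_step (anc + k) out h l | l <- iota 0 w] ++
  flatten [seq chain_step anc base a (k - i.+1) | i <- iota 0 k].

Definition lookup_table (k w anc base out : nat) (h : nat -> nat) : seq gate :=
  flatten [seq lookup k w anc base out a (h a) | a <- iota 0 (2 ^ k)].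

(** Qubit [m], the first ancilla, is set to 1 to serve as the empty conjunction that starts every
    chain of tests; the last [flip] resets it, as ancillas must end in 0. *)
Definition hash_circuit (k w m t : nat) (h : nat -> nat) : seq gate :=
  map GateH (iota 0 (k * t)) ++ flip m ++
  flatten [seq lookup_table k w m (k * j) (k * t + w * j) h | j <- iota 0 t] ++
  flip m.

(* The qubits below [S] hold the seeds, [k] bits each, and those from [S] to
   [U] their hashes, [w] bits each. *)
Definition hash_bits (k w S U : nat) (h : nat -> nat) (A : nat) : nat -> bool :=
  fun q => if q < S then qbit A q
           else (q < U) && qbit (h (block (2 ^ k) ((q - S) %/ w) A)) ((q - S) %% w).

Section Maps.
Variables (R : realType) (N : nat).

Lemma maps_ext C b1 b2 b1' b2' :
  (forall q, q < N -> b1 q = b2 q) -> (forall q, q < N -> b1' q = b2' q) ->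
  maps R N C b1 b1' -> maps R N C b2 b2'.
Proof. by rewrite /maps => /(eq_bvec R) -> /(eq_bvec R) ->. Qed.

Lemma maps_id b : maps R N [::] b b.
Proof. by []. Qed.

Lemma maps_cat C C' b b' b'' :
  maps R N C b b' -> maps R N C' b' b'' -> maps R N (C ++ C') b b''.
Proof.
case=> wC eC [wC' eC']; split; first by rewrite all_cat wC.
by rewrite apply_gates_cat eC eC'.
Qed.

Lemma maps_flatten n (f : nat -> seq gate) (st : nat -> nat -> bool) :
  (forall i, i < n -> maps R N (f i) (st i) (st i.+1)) ->
  maps R N (flatten [seq f i | i <- iota 0 n]) (st 0) (st n).
Proof.
elim: n => [_|n IH h]; first exact: maps_id.
rewrite -[in iota 0 n.+1]addn1 iotaD map_cat flatten_cat /= cats0.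
by apply: maps_cat (h n _) => //; apply: IH => i lti; apply/h/ltnW.
Qed.

Lemma maps_cnot c t b : c < N -> t < N -> c != t ->
  maps R N [:: GateCNOT c t] b (upd b t (b t (+) b c)).
Proof.
by move=> ltc ltt ne; split; [rewrite /= inE ne ltc ltt | apply: cnot_bvec].
Qed.

Lemma maps_toffoli c d t b : c < N -> d < N -> t < N -> c != d -> c != t -> d != t ->
  maps R N [:: GateToffoli c d t] b (upd b t (b t (+) (b c && b d))).
Proof.
move=> ltc ltd ltt n1 n2 n3; split; last exact: toffoli_bvec.
by rewrite /= !inE negb_or n1 n2 n3 ltc ltd ltt.
Qed.

Lemma maps_flip q b : q < N -> maps R N (flip q) b (upd b q (~~ b q)).
Proof. by move=> ltq; split; [rewrite /= ltq | apply: flip_bvec]. Qed.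

Section Lookup.
Variables (k w m base out : nat).
Hypotheses (baseP : base + k <= out) (outP : out + w <= m) (N_def : N = m + k.+1).

(** The state inside a lookup once [i] tests are recorded; for [i = 0] it is [b]. Read upwards the
    family describes the computation of the ancillas, read downwards their uncomputation. *)
Definition chain_bits (a : nat) (b : nat -> bool) (i : nat) : nat -> bool :=
  fun q => if m < q <= m + i
           then all (fun i' => b (base + i') == qbit a i') (iota 0 (q - m)) else b q.

Definition clean (b : nat -> bool) : Prop :=
  b m /\ forall i, i < k -> b (m + i.+1) = false.

Lemma chain_bits_step a b i : clean b -> i < k ->
  maps R N (chain_step m base a i) (chain_bits a b i) (chain_bits a b i.+1) /\
  maps R N (chain_step m base a i) (chain_bits a b i.+1) (chain_bits a b i).
Proof.
move=> [bm b0] lti.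
pose f := all (fun i' => b (base + i') == qbit a i') (iota 0 i).
have anc c : (c == i) || (c == i.+1) -> chain_bits a b c (m + i) = f.
  rewrite /chain_bits /f => hc; case: (posnP i) => [i0|ipos].
    by rewrite i0 addn0 ltnn /= bm.
  by rewrite ifT ?addKn //; case/orP: hc => /eqP ->; lia.
have seed c : chain_bits a b c (base + i) = b (base + i).
  by rewrite /chain_bits ifF //; lia.
have f1 : all (fun i' => b (base + i') == qbit a i') (iota 0 i.+1) =
    f && (b (base + i) == qbit a i).
  by rewrite -addn1 iotaD all_cat /= andbT.
(* The bit added to ancilla [m + i.+1] depends only on qubits that the states [i] and [i.+1] share,
   so one calculation serves both directions. *)
have step c : (c == i) || (c == i.+1) ->
    maps R N (chain_step m base a i) (chain_bits a b c)
      (upd (chain_bits a b c) (m + i.+1)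
        (chain_bits a b c (m + i.+1) (+) (f && (b (base + i) == qbit a i)))).
  move=> hc; rewrite /chain_step.
  have tof : maps R N [:: GateToffoli (m + i) (base + i) (m + i.+1)]
      (chain_bits a b c) (upd (chain_bits a b c) (m + i.+1)
        (chain_bits a b c (m + i.+1) (+) (f && b (base + i)))).
    by rewrite -(anc c) // -(seed c); apply: maps_toffoli; lia.
  case: (boolP (qbit a i)) => ai; first by rewrite eqb_id.
  rewrite -cat1s; apply: maps_cat tof _.
  apply: maps_ext (@maps_cnot (m + i) (m + i.+1) _ _ _ _) => // [q _|||]; try lia.
  rewrite /upd eqxx; case: eqP => // _.
  rewrite ifF; last by lia.
  rewrite anc // eqbF_neg.
  by move: (f) (b (base + i)) (chain_bits a b c (m + i.+1)) => [] [] [].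
have next : chain_bits a b i.+1 (m + i.+1) = f && (b (base + i) == qbit a i).
  by rewrite /chain_bits ifT ?addKn //; lia.
have cur : chain_bits a b i (m + i.+1) = false.
  by rewrite /chain_bits ifF ?b0 //; lia.
split.
  apply: maps_ext (step i _) => // [q _|]; last by rewrite eqxx.
  rewrite /upd; case: eqP => [->|/eqP ne]; first by rewrite cur next.
  rewrite /chain_bits; congr (if _ then _ else _); lia.
apply: maps_ext (step i.+1 _) => // [q _|]; last by rewrite eqxx orbT.
rewrite /upd; case: eqP => [->|/eqP ne]; first by rewrite next cur addbb.
rewrite /chain_bits; congr (if _ then _ else _); lia.
Qed.

Definition xor_bits (v : bool) (h : nat) (b : nat -> bool) (l : nat) : nat -> bool :=
  fun q => b q (+) [&& v, out <= q, q < out + l & qbit h (q - out)].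

Lemma maps_lookup a h b : clean b ->
  maps R N (lookup k w m base out a h) b
    (xor_bits (all (fun i => b (base + i) == qbit a i) (iota 0 k)) h b w).
Proof.
move=> cb; set v := all _ _; pose b' := xor_bits v h b w.
have cb' : clean b'.
  have big q : m <= q -> b' q = b q.
    by move=> leq; rewrite /b' /xor_bits [q < _]ltnNge (leq_trans outP) ?andbF ?addbF.
  by split=> [|i lti]; rewrite big ?cb.1 ?cb.2 ?leq_addr.
have start c : chain_bits a c 0 =1 c by move=> q; rewrite /chain_bits ifF //; lia.
apply: (@maps_cat _ _ b (chain_bits a b k)).
  apply: maps_ext (maps_flatten (n := k) (st := chain_bits a b) _) => [q _|//|i lti].
    exact: start.
  by have [] := chain_bits_step a cb lti.
(* The outputs lie beyond the seed, so the recorded tests are the same for [b] and [b']; the last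
   pass therefore undoes a computation that could have started from [b']. *)
apply: (@maps_cat _ _ (chain_bits a b k) (chain_bits a b' k)); last first.
  apply: maps_ext (maps_flatten (n := k) (f := fun i => chain_step m base a (k - i.+1))
    (st := fun i => chain_bits a b' (k - i)) _) => [q _|q _|i lti].
  - by rewrite subn0.
  - by rewrite subnn start.
  have lt' : k - i.+1 < k by lia.
  have [_] := chain_bits_step a cb' lt'.
  by rewrite (_ : (k - i.+1).+1 = k - i) //; lia.
have flag : chain_bits a b k (m + k) = v.
  rewrite /chain_bits; case: (posnP k) => [k0|kpos].
    by rewrite /v k0 addn0 ltnn /= cb.1.
  by rewrite ifT ?addKn //; lia.
apply: maps_ext (maps_flatten (n := w) (f := copy_step (m + k) out h)
  (st := xor_bits v h (chain_bits a b k)) _) => [q _|q _|l ltl].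
- rewrite /xor_bits addn0; case: (leqP out q) => hq; last by rewrite andbF addbF.
  by rewrite !andbF addbF.
- rewrite /xor_bits /b' /chain_bits; case: ifP => [hq|//].
  have -> : (q < out + w) = false by lia.
  rewrite !andbF addbF; apply: eq_in_all => i; rewrite mem_iota => hi.
  by rewrite /xor_bits (_ : (out <= base + i) = false) ?andbF ?addbF //; lia.
rewrite /copy_step.
have ext q : q <> out + l -> xor_bits v h (chain_bits a b k) l q =
    xor_bits v h (chain_bits a b k) l.+1 q.
  by move=> ne; rewrite /xor_bits; do 3 congr (_ && _) || congr (_ (+) _); lia.
case: (boolP (qbit h l)) => hl; last first.
  apply: maps_ext (maps_id _) => // q _.
  case: (q =P out + l) => [->|]; last exact: ext.
  by rewrite /xor_bits addKn (negPf hl) !andbF.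
apply: maps_ext (@maps_cnot (m + k) (out + l) _ _ _ _) => // [q _|||]; try lia.
rewrite /upd.
case: (q =P out + l) => [->|]; last exact: ext.
rewrite /xor_bits flag addKn hl.
have -> : (m + k < out + l) = false by lia.
have -> : (out + l < out + l) = false by lia.
have -> : (out + l < out + l.+1) by lia.
have -> : (out <= out + l) by lia.
by rewrite !andbF !andbT !addbF.
Qed.
End Lookup.
End Maps.

Lemma eq_bits_block k a c : a < 2 ^ k -> c < 2 ^ k ->
  all (fun i => qbit c i == qbit a i) (iota 0 k) = (c == a).
Proof.
move=> lta ltc; apply/allP/eqP => [e|-> i _]; last exact: eqxx.
by apply: (qbit_inj ltc lta) => r ltr; apply/eqP/e; rewrite mem_iota.
Qed.

Lemma maps_lookup_table (R : realType) k w m base out h beta b :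
  base + k <= out -> out + w <= m -> clean k m b ->
  beta < 2 ^ k -> (forall i, i < k -> b (base + i) = qbit beta i) ->
  maps R (m + k.+1) (lookup_table k w m base out h) b (xor_bits out true (h beta) b w).
Proof.
move=> baseP outP cb ltb eb.
(* Only the round [a = beta] passes its test: nothing has been added before it, the whole hash after
   it. *)
pose st a := xor_bits out (beta < a) (h beta) b w.
apply: maps_ext (maps_flatten (n := 2 ^ k) (st := st) _) => [q _|q _|a lta].
- by rewrite /st /xor_bits addbF.
- by rewrite /st ltb.
have cst : clean k m (st a).
  have big q : m <= q -> st a q = b q.
    move=> leq; rewrite /st /xor_bits [q < _]ltnNge (leq_trans outP) //.
    by rewrite !andbF addbF.
  by split=> [|i lti]; rewrite big ?cb.1 ?cb.2 ?leq_addr.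
have := @maps_lookup R _ k w m base out baseP outP erefl a (h a) _ cst.
rewrite (_ : all _ _ = (beta == a)); last first.
  rewrite -(@eq_bits_block k) //; apply: eq_in_all => i.
  rewrite mem_iota add0n /= => lti.
  by rewrite /st /xor_bits (_ : (out <= base + i) = false) ?andbF ?addbF ?eb //; lia.
apply: maps_ext => // q _; rewrite /st /xor_bits -addbA; congr (_ (+) _).
rewrite ltnS; case: (ltngtP beta a) => [||<-] /=; rewrite ?addbF //.
Qed.

Section HashCircuit.
Variables (R : realType) (k w m t : nat) (h : nat -> nat).
Hypotheses (tP : (k + w) * t <= m) (w0 : 0 < w).

Lemma maps_hash_table A : A < 2 ^ (k * t) ->
  maps R (m + k.+1)
   (flatten [seq lookup_table k w m (k * j) (k * t + w * j) h | j <- iota 0 t])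
   (upd (qbit A) m true)
   (upd (hash_bits k w (k * t) ((k + w) * t) h A) m true).
Proof.
move=> ltA.
have ktm : k * t <= m by nia.
(* The end [U] of [hash_bits] is a parameter for the sake of this induction: it advances by [w] with
   every table. *)
pose st j := upd (hash_bits k w (k * t) (k * t + w * j) h A) m true.
apply: maps_ext (maps_flatten (n := t) (st := st) _) => [q _|q _|j ltj].
- rewrite /st /upd /hash_bits; case: eqP => // _; case: ltnP => // leq.
  by rewrite muln0 addn0 ltnNge leq /= qbit_small // (leq_trans ltA) ?leq_exp2l.
- by rewrite /st mulnDl.
have kj : k * j + k <= k * t by rewrite -mulnSr leq_mul2l ltj orbT.
have wj : w * j + w <= w * t by rewrite -mulnSr leq_mul2l ltj orbT.
have tP' : k * t + w * t <= m by rewrite -mulnDl.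
have cst : clean k m (st j).
  split=> [|i lti]; first by rewrite /st /upd eqxx.
  rewrite /st /upd /hash_bits; have -> : (m + i.+1 == m) = false by lia.
  have -> : (m + i.+1 < k * t) = false by lia.
  by have -> : (m + i.+1 < k * t + w * j) = false by lia.
have := @maps_lookup_table R k w m (k * j) (k * t + w * j) h (block (2 ^ k) j A) (st j).
move=> /(_ _ _ cst _ _) H; apply: maps_ext (H _ _ _ _) => //; try lia.
- move=> q _; rewrite /xor_bits /st /upd; case: eqP => [->|ne].
    by rewrite (_ : (m < _) = false) ?andbF ?addbF //; lia.
  rewrite /hash_bits; case: ltnP => [ltq|leq].
    by rewrite (_ : (_ <= q) = false) ?andbF ?addbF //; lia.
  case: (ltnP q (k * t + w * j)) => [ltq|leq'] /=.
    by rewrite addbF (_ : q < _) //; lia.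
  have -> : (q < k * t + w * j + w) = (q < k * t + w * j.+1) by lia.
  case: ltnP => //= ltq.
  have e : q - k * t = j * w + (q - (k * t + w * j)) by lia.
  by rewrite e divnMDl // divn_small ?addn0 ?modnMDl ?modn_small //; lia.
- by rewrite ltn_mod expn_gt0.
move=> i lti; rewrite qbit_block // /st /upd (_ : (_ == m) = false); last by lia.
by rewrite /hash_bits ifT //; lia.
Qed.

Local Open Scope ring_scope.
Local Open Scope complex_scope.

Definition hash_state : 'cV[R[i]]_(2 ^ m) :=
  ((Num.sqrt 2)^-1 : R)%:C ^+ (k * t) *:
    \sum_(A <- iota 0 (2 ^ (k * t)))
       bvec R m (hash_bits k w (k * t) ((k + w) * t) h A).

Lemma with_ancillas_bvec a b : (forall q, (m <= q)%N -> b q = false) ->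
  with_ancillas a (bvec R m b) = bvec R (m + a) b.
Proof.
move=> b0; apply/colP => i; rewrite mxE bvecE eq_bits_ord.
case: insubP => [j ltj ej|leq].
  rewrite bvecE eq_bits_ord; congr (nat_of_bool _)%:R.
  apply/forallP/forallP => e r.
    case: (ltnP r m) => [ltr|ler]; first by have := e (Ordinal ltr); rewrite -ej.
    rewrite b0 // qbit_small //; apply: leq_trans ltj _.
    by rewrite leq_exp2l.
  by have := e (widen_ord (leq_addr a m) r); rewrite -ej.
case: forallP => // e; case/negP: leq.
have -> : (i : nat) = of_bits m b; last exact: of_bits_ltn.
apply: (@qbit_inj (m + a)) => [||r ltr]; first exact: ltn_ord.
  by apply: leq_trans (of_bits_ltn m b) _; rewrite leq_exp2l ?leq_addr.
have /eqP := e (Ordinal ltr); rewrite /= => ->.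
case: (ltnP r m) => [ltrm|ler]; first by rewrite qbit_of_bits.
rewrite b0 // qbit_small //; apply: leq_trans (of_bits_ltn m b) _.
by rewrite leq_exp2l.
Qed.

Lemma with_ancillas_scale a c (v : 'cV[R[i]]_(2 ^ m)) :
  with_ancillas a (c *: v) = c *: with_ancillas a v.
Proof.
by apply/colP => i; rewrite !mxE; case: insubP => [j _ _|_]; rewrite ?mxE ?mulr0.
Qed.

Lemma with_ancillas_sum a I (r : seq I) (F : I -> 'cV[R[i]]_(2 ^ m)) :
  with_ancillas a (\sum_(i <- r) F i) = \sum_(i <- r) with_ancillas a (F i).
Proof.
apply/colP => i; rewrite summxE mxE; under [RHS]eq_bigr do rewrite mxE.
by case: insubP => [j _ _|_]; rewrite ?summxE // big1.
Qed.

Lemma hash_bits_out A q : ((k + w) * t <= q)%N ->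
  hash_bits k w (k * t) ((k + w) * t) h A q = false.
Proof.
move=> leq; rewrite /hash_bits !ltnNge leq (leq_trans _ leq) //.
by rewrite leq_mul2r leq_addr orbT.
Qed.

(** After the Hadamard layer linearity leaves only basis vectors to follow. The [k.+1] ancillas are
    the constant 1 and the [k] tests. *)
Lemma prepares_hash_state : prepares k.+1 (hash_circuit k w m t h) hash_state.
Proof.
have ktm : (k * t <= m)%N by rewrite (leq_trans _ tP) // leq_mul2r leq_addr orbT.
have ktm' : (k * t <= m + k.+1)%N by rewrite (leq_trans ktm) ?leq_addr.
have maps0 A : (A < 2 ^ (k * t))%N -> maps R (m + k.+1)
    (flip m ++
     flatten [seq lookup_table k w m (k * j) (k * t + w * j) h | j <- iota 0 t] ++
     flip m) (qbit A) (hash_bits k w (k * t) ((k + w) * t) h A).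
  move=> ltA; have ltm : (m < m + k.+1)%N by lia.
  have f1 := maps_flip R (qbit A) ltm.
  have f2 : maps R (m + k.+1) (flip m)
      (upd (hash_bits k w (k * t) ((k + w) * t) h A) m true)
      (hash_bits k w (k * t) ((k + w) * t) h A).
    apply: maps_ext (maps_flip _ _ ltm) => // q _.
    by rewrite /upd eqxx; case: eqP => // ->; rewrite hash_bits_out.
  apply: (maps_cat f1); apply: maps_cat f2.
  apply: maps_ext (maps_hash_table ltA) => // q _; rewrite /upd; case: eqP => // _.
  by rewrite qbit_small // (leq_trans ltA) // leq_exp2l.
split.
  rewrite /hash_circuit all_cat; apply/andP; split; last first.
    by have [] := maps0 0%N _; rewrite ?expn_gt0.
  rewrite all_map; apply/allP => q; rewrite mem_iota add0n /= => ltq.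
  exact: leq_trans ltq ktm'.
rewrite /run_circuit -/(apply_gates _ _) apply_gates_cat hadamard_layer //.
rewrite apply_gates_scale apply_gates_sum with_ancillas_scale with_ancillas_sum.
congr (_ *: _); rewrite big_seq [RHS]big_seq; apply: eq_bigr => A.
rewrite mem_iota => /andP[_ ltA]; have [_ ->] := maps0 A ltA.
by rewrite with_ancillas_bvec // => q leq; rewrite hash_bits_out // (leq_trans tP).
Qed.
End HashCircuit.

(** * Overlaps and resilience *)

Section Overlap.
Variable R : realType.
Local Open Scope ring_scope.
Local Open Scope complex_scope.
Local Open Scope sesquilinear_scope.

Lemma dotcE d (u v : 'cV[R[i]]_d) : dotc u v = \sum_i (u i 0)^*%R * v i 0.
Proof. by rewrite /dotc mxE; apply: eq_bigr => i _; rewrite !mxE. Qed.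

Lemma dotcZl d c (u v : 'cV[R[i]]_d) : dotc (c *: u) v = c^*%R * dotc u v.
Proof.
by rewrite !dotcE big_distrr /=; apply: eq_bigr => i _; rewrite mxE rmorphM mulrA.
Qed.

Lemma dotcZr d c (u v : 'cV[R[i]]_d) : dotc u (c *: v) = c * dotc u v.
Proof. by rewrite /dotc -scalemxAr mxE. Qed.

Lemma dotc_suml d I (r : seq I) (F : I -> 'cV[R[i]]_d) v :
  dotc (\sum_(i <- r) F i) v = \sum_(i <- r) dotc (F i) v.
Proof.
rewrite dotcE; under [RHS]eq_bigr do rewrite dotcE.
rewrite exchange_big /=; apply: eq_bigr => j _.
by rewrite summxE rmorph_sum big_distrl.
Qed.

Lemma dotc_sumr d I (r : seq I) (F : I -> 'cV[R[i]]_d) u :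
  dotc u (\sum_(i <- r) F i) = \sum_(i <- r) dotc u (F i).
Proof. by rewrite /dotc mulmx_sumr summxE. Qed.

Lemma dotc_bvec N b b' :
  dotc (bvec R N b) (bvec R N b') = (bits_ord N b == bits_ord N b')%:R.
Proof.
rewrite dotcE (bigD1 (bits_ord N b)) //= big1 => [|i ne]; rewrite !bvecE.
  by rewrite eqxx conjC1 mul1r addr0.
by rewrite (negPf ne) conjC0 mul0r.
Qed.

(** The seeds are part of the basis vector, hence [A == A']; the bounds by [2 ^ w] ensure that the
    [w] bits written for a hash determine it. *)
Lemma eq_hash_bits k w m t h h' A A' :
  ((k + w) * t <= m)%N -> (0 < w)%N ->
  (forall a, h a < 2 ^ w)%N -> (forall a, h' a < 2 ^ w)%N ->
  (A < 2 ^ (k * t))%N -> (A' < 2 ^ (k * t))%N ->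
  (bits_ord m (hash_bits k w (k * t) ((k + w) * t) h A) ==
   bits_ord m (hash_bits k w (k * t) ((k + w) * t) h' A')) =
  (A == A') && all (fun j => h (block (2 ^ k) j A) == h' (block (2 ^ k) j A)) (iota 0 t).
Proof.
move=> tP w0 hw hw' ltA ltA'; rewrite eq_bits_ord.
rewrite mulnDl in tP *.
apply/forallP/andP => [e|[/eqP <- /allP e] r]; last first.
  rewrite /= qbit_of_bits // /hash_bits; case: ltnP => // ler.
  case: (ltnP r (k * t + w * t)) => //= ltr; apply/eqP.
  congr qbit; apply/eqP/e; rewrite mem_iota add0n /= ltn_divLR // mulnC; lia.
have {}e q : (q < m)%N -> hash_bits k w (k * t) (k * t + w * t) h A q =
    hash_bits k w (k * t) (k * t + w * t) h' A' q.
  by move=> ltq; apply/eqP; have := e (Ordinal ltq); rewrite /= qbit_of_bits.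
have eA : A = A'.
  apply: (qbit_inj ltA ltA') => q ltq; have := e q _.
  by rewrite /hash_bits ltq; apply; lia.
split; first by rewrite eA.
apply/allP => j; rewrite mem_iota add0n /= => ltj; apply/eqP.
apply: (qbit_inj (hw _) (hw' _)) => l ltl.
have wj : (j * w + w <= w * t)%N by rewrite [(w * t)%N]mulnC -mulSnr leq_mul2r ltj orbT.
have := e (k * t + (j * w + l))%N.
have -> : (k * t + (j * w + l) < m)%N by lia.
move=> /(_ isT); rewrite /hash_bits ltnNge leq_addr /= addKn.
rewrite divnMDl // divn_small // modnMDl modn_small // addn0 -eA.
by have -> : (k * t + (j * w + l) < k * t + w * t)%N by lia.
Qed.

Lemma dotc_hash_state k w m t h h' :
  ((k + w) * t <= m)%N -> (0 < w)%N ->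
  (forall a, h a < 2 ^ w)%N -> (forall a, h' a < 2 ^ w)%N ->
  dotc (hash_state R k w m t h) (hash_state R k w m t h') =
  (((count (fun a => h a == h' a) (iota 0 (2 ^ k)))%:R / 2 ^+ k) ^+ t : R)%:C.
Proof.
move=> tP w0 hw hw'; rewrite /hash_state dotcZl dotcZr mulrA.
have -> : (((Num.sqrt 2)^-1 : R)%:C ^+ (k * t))^*%R * ((Num.sqrt 2)^-1 : R)%:C ^+ (k * t)
    = ((2 ^+ k) ^- t : R)%:C.
  rewrite rmorphXn -exprMn.
  have -> : ((((Num.sqrt 2)^-1 : R)%:C)^*%R * ((Num.sqrt 2)^-1 : R)%:C : R[i]) =
      ((2^-1 : R)%:C).
    rewrite -[X in _ = X%:C](sqr_sqrtr (_ : 0 <= 2^-1)) ?invr_ge0 ?ler0n //.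
    rewrite sqrtrV ?ler0n // rmorphXn /= expr2; congr (_ * _).
    by apply/eqP; rewrite eq_complex /= oppr0 !eqxx.
  by rewrite -rmorphXn /= exprVn exprM.
rewrite dotc_suml; under eq_bigr do rewrite dotc_sumr.
have -> : \sum_(A <- iota 0 (2 ^ (k * t))) \sum_(A' <- iota 0 (2 ^ (k * t)))
    dotc (bvec R m (hash_bits k w (k * t) ((k + w) * t) h A))
      (bvec R m (hash_bits k w (k * t) ((k + w) * t) h' A')) =
    (count (fun a => h a == h' a) (iota 0 (2 ^ k)) ^ t)%:R :> R[i].
  (* Only the terms [A = A'] whose blocks all collide survive; independence of the blocks makes
     their number a [t]-th power. *)
  rewrite -count_blocks ?expn_gt0 // -expnM -sum1_count natr_sum [RHS]big_mkcond /=.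
  rewrite big_seq [RHS]big_seq; apply: eq_bigr => A; rewrite mem_iota => /andP[_ ltA].
  rewrite (bigD1_seq A) ?iota_uniq ?mem_iota //= big_seq_cond big1 => [|A'].
    by rewrite dotc_bvec eq_hash_bits // eqxx addr0; case: all.
  rewrite mem_iota => /andP[/andP[_ ltA'] ne].
  by rewrite dotc_bvec eq_hash_bits // eq_sym (negPf ne).
rewrite expr_div_n rmorphM mulrC; congr (_ * _).
by rewrite natrX rmorphXn /= rmorph_nat.
Qed.
End Overlap.

(** * Resilience from small overlaps *)

Section Resilience.
Variable R : realType.
Local Open Scope ring_scope.
Local Open Scope complex_scope.
Local Open Scope sesquilinear_scope.

Lemma mxtrace_tens m n (A : 'M[R[i]]_m) (B : 'M[R[i]]_n) :
  \tr (A *t B) = \tr A * \tr B.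
Proof.
rewrite /mxtrace big_distrlr /= pair_big /=.
rewrite (reindex (@mxtens_index m n)) /=; last first.
  by exists (@mxtens_unindex m n) => i _; rewrite (mxtens_indexK, mxtens_unindexK).
by apply: eq_bigr => -[i j] _; rewrite tensmxE.
Qed.

Lemma mxtrace_proj_mul d (u : 'cV[R[i]]_d) (M : 'M[R[i]]_d) :
  \tr (Defs.proj u *m M) = dotc u (M *m u).
Proof.
by rewrite /Defs.proj -mulmxA mxtrace_mulC /mxtrace big_ord1 /dotc mulmxA.
Qed.

Lemma dotcC d (u v : 'cV[R[i]]_d) : dotc v u = (dotc u v)^*%R.
Proof.
rewrite !dotcE rmorph_sum; apply: eq_bigr => i _.
by rewrite rmorphM /= conjCK mulrC.
Qed.

Lemma dotc_ket n (x x' : n.-tuple bool) : dotc (ket R x) (ket R x') = (x == x')%:R.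
Proof.
rewrite dotcE (bigD1 (enum_rank x)) //= big1 => [|i ne]; rewrite /ket !mxE !eqxx !andbT.
  by rewrite (inj_eq enum_rank_inj) conjC1 mul1r addr0.
by rewrite (negPf ne) conjC0 mul0r.
Qed.

Lemma normcE (z : R[i]) : `|z| = (Normc.normc z)%:C.
Proof. by rewrite normc_def; case: z. Qed.

Lemma passing_probE n m (phi : n.-tuple bool -> 'cV[R[i]]_(2 ^ m)) (Y : finType)
    (p : n.-tuple bool -> Y -> R) (sigma : Y -> 'M[R[i]]_(2 ^ m)) :
  passing_prob phi (forgery_state p sigma) =
  complex.Re (\sum_y \sum_x (p x y)%:C * dotc (phi x) (sigma y *m phi x)).
Proof.
congr complex.Re; rewrite exchange_big /= /verification /forgery_state.
rewrite mulmx_suml raddf_sum; apply: eq_bigr => x _ /=.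
rewrite mulmx_sumr raddf_sum (bigD1 x) //= [X in _ + X]big1 => [|x' ne]; last first.
  rewrite mulmx_sumr raddf_sum big1 // => y _.
  rewrite -scalemxAr tensmx_mul /= mxtraceZ mxtrace_tens mxtrace_proj_mul.
  by rewrite /Defs.proj -mulmxA /dotc !mulmxA -[_ *m _ *m _ *m _]mulmxA mxE big_ord1
    -/(dotc _ _) dotc_ket eq_sym (negPf ne) mul0r mul0r mulr0.
rewrite addr0 mulmx_sumr raddf_sum; apply: eq_bigr => y _ /=.
rewrite -scalemxAr tensmx_mul mxtraceZ mxtrace_tens !mxtrace_proj_mul.
have -> : Defs.proj (ket R x) *m ket R x = ket R x.
  rewrite /Defs.proj -mulmxA; have -> : (ket R x) ^t* *m ket R x = 1%:M.
    by apply/matrixP => i j; rewrite !ord1 -/(dotc _ _) dotc_ket eqxx mxE.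
  by rewrite mulmx1.
by rewrite dotc_ket eqxx mul1r.
Qed.

Section Density.
Variables (d : nat) (sigma : 'M[R[i]]_d).
Hypothesis sigmaP : is_density sigma.

Let f (u v : 'cV[R[i]]_d) := dotc u (sigma *m v).

Lemma density_ge0 u : 0 <= f u u.
Proof. by case: sigmaP => _ psd _; apply: psd. Qed.

Lemma density_conj u v : f v u = (f u v)^*%R.
Proof.
case: sigmaP => /is_hermitianmxP herm _ _.
rewrite /f -dotcC /dotc trmx_mul map_mxM {1}herm expr0 scale1r -mulmxA.
by congr (_ 0 0).
Qed.

Lemma density_subl u u' v : f (u - u') v = f u v - f u' v.
Proof. by rewrite /f /dotc linearB map_mxB mulmxBl !mxE. Qed.

Lemma density_subr u v v' : f u (v - v') = f u v - f u v'.
Proof. by rewrite /f mulmxBr /dotc mulmxBr !mxE. Qed.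

(** Positivity of the form at [e *: u - v], where [e] is the phase of [f u v]. Unlike the geometric
    mean of Cauchy-Schwarz, the arithmetic mean is linear in the diagonal values and can be summed
    over pairs. *)
Lemma norm_density_le u v : `|f u v| <= (f u u + f v v) / 2.
Proof.
have [-> | nz] := eqVneq (f u v) 0.
  by rewrite normr0 divr_ge0 ?addr_ge0 ?density_ge0.
set z := f u v; pose e := z / `|z|.
have nz' : `|z| != 0 by rewrite normr_eq0.
have ez : e^*%R * z = `|z|.
  by rewrite /e fmorph_div /= conj_normC mulrAC [_^*%R * z]mulrC -normCK expr2 mulfK.
have ee : e^*%R * e = 1 by rewrite {2}/e mulrA ez divff.
have := density_ge0 (e *: u - v).
rewrite density_subl !density_subr /f -!scalemxAr !dotcZl !dotcZr -!/(f _ _).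
rewrite (density_conj u v) -/z mulrA ee mul1r ez.
have -> : e * z^*%R = `|z|.
  by rewrite -[LHS]conjCK rmorphM /= conjCK ez conj_normC.
move=> h; rewrite ler_pdivlMr ?ltr0n // -subr_ge0.
by apply: le_trans h _; rewrite le_eqVlt; apply/orP; left; apply/eqP; ring.
Qed.

Lemma mxtrace_density_ge0 (B : 'M[R[i]]_d) : 0 <= \tr (B ^t* *m (sigma *m B)).
Proof.
apply: sumr_ge0 => i _; rewrite (_ : _ i i = f (col i B) (col i B)) ?density_ge0 //.
rewrite /f dotcE mxE; apply: eq_bigr => j _; rewrite !mxE; congr (_ * _).
by apply: eq_bigr => l _; rewrite mxE.
Qed.

(* With [A = \sum_x q x |phi x><phi x|] and [X = tr (sigma A)], positivity of
   [tr ((A - X) sigma (A - X))] gives [X ^ 2 <= tr (sigma A ^ 2)], and the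
   right-hand side is at most [(w + delta * \sum_x q x) X]. *)
Lemma guess_overlap_bound (T : finType) (phi : T -> 'cV[R[i]]_d) (q : T -> R)
    (w delta : R) :
  (forall x, 0 <= q x <= w) -> 0 <= w -> 0 <= delta ->
  (forall x, dotc (phi x) (phi x) = 1) ->
  (forall x x', x != x' -> `|dotc (phi x) (phi x')| <= delta%:C) ->
  \sum_x (q x)%:C * dotc (phi x) (sigma *m phi x) <= (w + delta * \sum_x q x)%:C.
Proof.
move=> hq w0 delta0 phi1 phi_le.
pose c x : R[i] := (q x)%:C; pose F x := f (phi x) (phi x).
pose X := \sum_x c x * F x; pose A := \sum_x c x *: Defs.proj (phi x).
have c0 x : 0 <= c x by rewrite ler0c; case/andP: (hq x).
have F0 x : 0 <= F x by apply: density_ge0.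
have X0 : 0 <= X by apply: sumr_ge0 => x _; rewrite mulr_ge0.
have hA : A ^t* = A.
  rewrite /A linear_sum /= map_mx_sum; apply: eq_bigr => x _.
  rewrite linearZ /= map_mxZ trmx_mul map_mxM; congr (_ *: _).
    by rewrite /= conj_Creal // ger0_real.
  by congr (_ *m _); apply/matrixP => i j; rewrite !mxE /= conjCK.
have trA M : \tr (A *m M) = \sum_x c x * dotc (phi x) (M *m phi x).
  rewrite mulmx_suml raddf_sum; apply: eq_bigr => x _ /=.
  by rewrite -scalemxAl mxtraceZ mxtrace_proj_mul.
have trA2 : \tr (A *m (A *m sigma)) = \sum_x \sum_x' c x * c x' *
    (dotc (phi x) (phi x') * f (phi x') (phi x)).
  rewrite trA; apply: eq_bigr => x _.
  rewrite -mulmxA /A mulmx_suml dotc_sumr big_distrr; apply: eq_bigr => x' _ /=.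
  rewrite -scalemxAl dotcZr /Defs.proj -mulmxA mulrA.
  by rewrite [_ ^t* *m _]mx11_scalar mul_mx_scalar dotcZr [X in _ * X]mulrC.
have sq : X ^+ 2 <= \tr (A *m (A *m sigma)).
  have := mxtrace_density_ge0 (A - X%:M).
  have -> : (A - X%:M) ^t* = A - X%:M.
    rewrite linearB /= map_mxB hA tr_scalar_mx map_scalar_mx /=.
    by rewrite /= conj_Creal // ger0_real.
  rewrite mulmxBl !mulmxBr mul_scalar_mx mul_mx_scalar !linearB /= -?scalemxAr.
  have eX : \tr (A *m sigma) = X by rewrite trA.
  rewrite !mxtraceZ [\tr (sigma *m A)]mxtrace_mulC !eX.
  have -> : \tr (A *m (sigma *m A)) = \tr (A *m (A *m sigma)).
    by rewrite mulmxA mxtrace_mulC.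
  case: sigmaP => _ _ tr1; rewrite mul_scalar_mx mxtraceZ tr1 mulr1 opprK addNr.
  by rewrite addr0 subr_ge0 expr2.
have le2 : \tr (A *m (A *m sigma)) <= (w + delta * \sum_x q x)%:C * X.
  have tr0 := le_trans (exprn_ge0 2 X0) sq.
  rewrite -(ger0_norm tr0) trA2; apply: le_trans (ler_norm_sum _ _ _) _.
  (* The pairs [x = x'] are charged the [delta] term too, so that it runs over all pairs and its sum
     factors as [(\sum_x c x) * X]. *)
  apply: le_trans (_ : \sum_x \sum_x' c x * c x' *
     ((x == x')%:R * F x + delta%:C * ((F x + F x') / 2)) <= _).
    apply: ler_sum => x _; apply: le_trans (ler_norm_sum _ _ _) _.
    apply: ler_sum => x' _; rewrite normrM ger0_norm ?mulr_ge0 //.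
    apply: ler_wpM2l; first exact: mulr_ge0.
    have d0 z : 0 <= delta%:C * ((F x + F z) / 2).
      by rewrite mulr_ge0 ?ler0c // divr_ge0 ?addr_ge0.
    rewrite normrM; have [<-|ne] := eqVneq x x'.
      by rewrite phi1 normr1 !mul1r (ger0_norm (F0 x)) lerDl d0.
    rewrite mul0r add0r; apply: ler_pM => //; first exact: phi_le.
    by rewrite addrC; apply: norm_density_le.
  have -> : \sum_x \sum_x' c x * c x' *
     ((x == x')%:R * F x + delta%:C * ((F x + F x') / 2)) =
     \sum_x c x * c x * F x + delta%:C * ((\sum_x c x) * X).
    have -> : (\sum_x c x) * X = \sum_x \sum_x' (c x * c x' * ((F x + F x') / 2)).
      have e : (\sum_x c x) * X = \sum_x \sum_x' c x * c x' * F x'.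
        by rewrite big_distrlr /=; do 2 (apply: eq_bigr => ? _); rewrite mulrA.
      have e' : (\sum_x c x) * X = \sum_x \sum_x' c x * c x' * F x.
        rewrite mulrC big_distrlr /=; do 2 (apply: eq_bigr => ? _).
        by rewrite mulrAC.
      have -> : (\sum_x c x) * X = ((\sum_x c x) * X + (\sum_x c x) * X) / 2.
        by field.
      rewrite {1}e' e -big_split big_distrl; apply: eq_bigr => x _.
      rewrite -big_split big_distrl; apply: eq_bigr => x' _ /=.
      by field.
    rewrite big_distrr -big_split; apply: eq_bigr => x _ /=.
    rewrite big_distrr /= (bigD1 x) //= [in RHS](bigD1 x) //= eqxx mul1r.
    rewrite mulrDr -!addrA; congr (_ + _); rewrite mulrCA; congr (_ + _).
    by apply: eq_bigr => x' ne; rewrite eq_sym (negPf ne) mul0r add0r mulrCA.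
  rewrite rmorphD rmorphM rmorph_sum /= mulrDl mulrA lerD2r big_distrr /=.
  apply: ler_sum => x _; rewrite mulrA; apply: ler_wpM2r => //.
  by apply: ler_wpM2r => //; rewrite lecR; case/andP: (hq x).
(* What is left is to cancel one factor [X], hence the separate case of 0. *)
rewrite -[leLHS]/X; have [->|nz] := eqVneq X 0.
  rewrite ler0c addr_ge0 ?mulr_ge0 ?sumr_ge0 // => x _.
  by case/andP: (hq x).
have Xpos : 0 < X by rewrite lt_def nz.
by rewrite -(ler_pM2r Xpos) -expr2 (le_trans sq).
Qed.
End Density.

(** Positivity allows the logarithm in [Hmin] to be inverted. Always guessing one fixed string
    already succeeds with probability [2 ^ - n]. *)
Lemma guessing_prob_gt0 n (Y : finType) (p : n.-tuple bool -> Y -> R) :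
  is_side_info p -> 0 < guessing_prob p.
Proof.
move=> [p0 p1]; pose x0 : n.-tuple bool := [tuple of nseq n false].
apply: lt_le_trans (_ : \sum_y p x0 y <= _); last first.
  by apply: ler_sum => y _; apply: (le_bigmax 0 (fun x => p x y)).
by rewrite p1 invr_gt0 exprn_gt0.
Qed.

Lemma guessing_prob_le n (Y : finType) (p : n.-tuple bool -> Y -> R) l :
  is_side_info p -> has_leakage p l -> guessing_prob p <= 2 `^ (l - n%:R).
Proof.
move=> hp; have pg0 := guessing_prob_gt0 hp.
rewrite /has_leakage /Hmin opprK /log2 => hl.
rewrite /powR pnatr_eq0 /= -[leLHS]lnK ?posrE // ler_expR.
have ln2 : 0 < ln 2 :> R by rewrite ln_gt0 // ltr1n.
by rewrite -ler_pdivrMr // lerBrDl.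
Qed.

Lemma max_overlap_ge0 n m (phi : n.-tuple bool -> 'cV[R[i]]_(2 ^ m)) :
  0 <= max_overlap phi.
Proof. exact: bigmax_ge_id. Qed.

Lemma forgery_sup_le n m (phi : n.-tuple bool -> 'cV[R[i]]_(2 ^ m)) l :
  (forall x, dotc (phi x) (phi x) = 1) ->
  forgery_sup phi l <= 2 `^ (l - n%:R) + max_overlap phi.
Proof.
move=> phi1; rewrite /forgery_sup; set E := [set _ | _]%classic.
(* There may be no forgery state at all, for instance when [l] is negative; [sup] then takes its
   default value 0. *)
have [ne|ne] := pselect (E !=set0)%classic; last first.
  by rewrite sup_out ?addr_ge0 ?powR_ge0 ?max_overlap_ge0 // => -[].
apply: ge_sup => // _ [Y [p [sigma [hp hl hs ->]]]].
rewrite passing_probE -lecR.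
have pE0 x y : 0 <= (p x y)%:C * dotc (phi x) (sigma y *m phi x).
  by rewrite mulr_ge0 ?ler0c ?(hp.1 x y) //; case: (hs y).
rewrite RRe_real; last by apply/ger0_real/sumr_ge0 => y _; apply: sumr_ge0.
apply: le_trans (_ : (\sum_y (\big[Num.max/0]_x p x y +
    max_overlap phi * \sum_x p x y))%:C <= _).
  rewrite rmorph_sum; apply: ler_sum => y _.
  apply: (guess_overlap_bound (hs y)) => //.
  - by move=> x; rewrite hp.1 (le_bigmax 0 (fun x => p x y)).
  - exact: bigmax_ge_id.
  - exact: max_overlap_ge0.
  move=> x x' nxx'; rewrite normcE lecR.
  exact: (le_bigmax_cond 0 (fun q : n.-tuple bool * n.-tuple bool =>
    Normc.normc (dotc (phi q.1) (phi q.2))) (j := (x, x')) nxx').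
(* The overlap is multiplied by the total probability: [2 ^ n] strings of probability [2 ^ - n]
   each. *)
rewrite lecR big_split -big_distrr /= exchange_big /=.
rewrite (eq_bigr _ (fun x _ => hp.2 x)) big_const iter_addr_0 card_tuple card_bool.
rewrite -[_ *+ _]mulr_natr natrX mulVf ?mulr1 ?expf_neq0 ?pnatr_eq0 // lerD2r.
exact: guessing_prob_le.
Qed.
End Resilience.

(** * The program *)

(* A bound on the running time, provided that each loop iterates at most [Z]
   times whenever it is entered. *)
Fixpoint cost (Z : nat) (P : prog) : nat :=
  match P with
  | Skip | Put _ _ _ | Apply _ => 1
  | Seq P Q => cost Z P + cost Z Q
  | If _ P Q => (cost Z P + cost Z Q).+1
  | While _ P => Z * (cost Z P).+1 + 1
  end.

(** * Polynomial growth of the cost *)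

Definition poly_bounded (f : nat -> nat) : Prop :=
  exists c, forall z, f z <= c * z.+1 ^ c.

Lemma poly_bounded_weaken c c' z : c <= c' -> c * z.+1 ^ c <= c' * z.+1 ^ c'.
Proof. by move=> le; rewrite leq_mul // leq_pexp2l. Qed.

Lemma poly_bounded_const k : poly_bounded (fun=> k).
Proof. by exists k => z; rewrite leq_pmulr // expn_gt0. Qed.

Lemma poly_bounded_id : poly_bounded id.
Proof. by exists 1 => z; rewrite expn1 mul1n. Qed.

Lemma poly_bounded_add f g :
  poly_bounded f -> poly_bounded g -> poly_bounded (fun z => f z + g z).
Proof.
move=> [c hf] [d hg]; exists (c + d) => z.
rewrite mulnDl leq_add // ?(leq_trans (hf z)) ?(leq_trans (hg z)) //;
  by rewrite leq_mul // leq_pexp2l // ?leq_addr ?leq_addl.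
Qed.

Lemma poly_bounded_mul f g :
  poly_bounded f -> poly_bounded g -> poly_bounded (fun z => f z * g z).
Proof.
move=> [c hf] [d hg]; exists (c + d + c * d) => z.
apply: leq_trans (leq_mul (hf z) (hg z)) _.
rewrite mulnACA -expnD; apply: leq_mul; first exact: leq_addl.
by rewrite leq_pexp2l // leq_addr.
Qed.

Lemma poly_bounded_comp f g : {homo f : x y / x <= y} ->
  poly_bounded f -> poly_bounded g -> poly_bounded (f \o g).
Proof.
move=> homo [c hf] [d hg].
have [e he] : poly_bounded (fun z => c * (d * z.+1 ^ d).+1 ^ c).
  apply: poly_bounded_mul (poly_bounded_const c) _.
  have pS : poly_bounded (fun z => (d * z.+1 ^ d).+1).
    exists d.+1 => z; rewrite -addn1 mulSn addnC leq_add ?expn_gt0 //.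
    by rewrite leq_mul // leq_pexp2l.
  elim: {homo hf hg}c => [|c IH]; first exact: (poly_bounded_const 1).
  have [e he] := poly_bounded_mul pS IH.
  by exists e => z; rewrite expnS.
exists e => z; apply: leq_trans (he z).
exact: leq_trans (homo _ _ (hg z)) (hf _).
Qed.

Lemma cost_homo P : {homo cost^~ P : x y / x <= y}.
Proof.
move=> x y le; elim: P => //= [P IHP Q IHQ|_ P IHP Q IHQ|_ P IHP].
- exact: leq_add.
- by rewrite ltnS leq_add.
- by rewrite leq_add2r leq_mul.
Qed.

(** For a fixed program the cost is a polynomial in [Z] of degree the nesting depth of its loops.
    Efficiency thus reduces to one polynomial bound on all iteration counts. *)
Lemma poly_bounded_cost P : poly_bounded (cost^~ P).
Proof.
elim: P => [||//|P IHP Q IHQ|e P IHP Q IHQ|e P IHP] /=;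
  try (by move=> *; exact: poly_bounded_const).
- exact: poly_bounded_add.
- have [c hc] := poly_bounded_add (poly_bounded_const 1) (poly_bounded_add IHP IHQ).
  by exists c.
apply: poly_bounded_add (poly_bounded_const 1).
apply: poly_bounded_mul poly_bounded_id _.
have [c hc] := poly_bounded_add (poly_bounded_const 1) IHP.
by exists c.
Qed.

(** Total correctness. The time bound depends on the program text alone, so postconditions speak
    only of the final store and the issued gates. *)
Definition wp (Z : nat) (P : prog) (s : store) (Phi : store -> seq gate -> Prop) : Prop :=
  exists t s' C, [/\ exec P s t s' C, t <= cost Z P & Phi s' C].

Section WP.
Variable Z : nat.

Lemma wp_skip s (Phi : store -> seq gate -> Prop) : Phi s [::] -> wp Z Skip s Phi.
Proof. by exists 1, s, [::]; split=> //; constructor. Qed.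

Lemma wp_put a e v s (Phi : store -> seq gate -> Prop) :
  Phi (put s a (Defs.eval s e) (Defs.eval s v)) [::] -> wp Z (Put a e v) s Phi.
Proof. by move=> h; exists 1; eexists _, _; split; [constructor| |exact: h]. Qed.

Lemma wp_apply g s (Phi : store -> seq gate -> Prop) :
  Phi s [:: eval_gate s g] -> wp Z (Apply g) s Phi.
Proof. by move=> h; exists 1; eexists _, _; split; [constructor| |exact: h]. Qed.

Lemma wp_seq P Q s (Phi : store -> seq gate -> Prop) :
  wp Z P s (fun s1 C1 => wp Z Q s1 (fun s2 C2 => Phi s2 (C1 ++ C2))) ->
  wp Z (Seq P Q) s Phi.
Proof.
move=> [t1 [s1 [C1 [e1 l1 [t2 [s2 [C2 [e2 l2 h]]]]]]]].
by exists (t1 + t2), s2, (C1 ++ C2); split; [exact: exec_seq e1 e2|exact: leq_add|].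
Qed.

Lemma wp_if e P Q s (Phi : store -> seq gate -> Prop) :
  wp Z (if Defs.eval s e != 0 then P else Q) s Phi -> wp Z (If e P Q) s Phi.
Proof.
move=> [t [s' [C [ex l h]]]]; exists t.+1, s', C; split=> //; first exact: exec_if.
by rewrite /= ltnS (leq_trans l) //; case: ifP => _; rewrite ?leq_addr ?leq_addl.
Qed.

(** [N] is the exact number of iterations, and the gates in the invariant are those issued since the
    loop was entered. Induction on the remaining iterations gives termination and the time bound
    together. *)
Lemma wp_while e P s (Phi : store -> seq gate -> Prop) N
    (I : nat -> store -> seq gate -> Prop) :
  N <= Z -> I 0 s [::] ->
  (forall i s C, i < N -> I i s C ->
     Defs.eval s e != 0 /\ wp Z P s (fun s' C' => I i.+1 s' (C ++ C'))) ->
  (forall s C, I N s C -> Defs.eval s e = 0 /\ Phi s C) ->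
  wp Z (While e P) s Phi.
Proof.
move=> leN I0 step stop.
suff: forall k i s0 C, k + i = N -> I i s0 C -> exists t s' C',
    [/\ exec (While e P) s0 t s' C', t <= k * (cost Z P).+1 + 1 & Phi s' (C ++ C')].
  move=> /(_ N 0 s [::] (addn0 _) I0) [t [s' [C [ex l h]]]]; exists t, s', C.
  by split=> //; apply: leq_trans l _; rewrite leq_add2r leq_mul2r leN orbT.
elim=> [|k IH] i s0 C.
  rewrite add0n => -> /stop[e0 h]; exists 1, s0, [::]; rewrite cats0.
  by split=> //; apply: exec_while_stop.
move=> eN Ii; have lti : i < N by lia.
have [/eqP ne [t1 [s1 [C1 [ex1 l1 I1]]]]] := step i s0 C lti Ii.
have [|t2 [s2 [C2 [ex2 l2 h]]]] := IH i.+1 s1 _ _ I1; first by lia.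
exists (t1 + t2).+1, s2, (C1 ++ C2); rewrite catA; split=> //.
  exact: exec_while_loop ne ex1 ex2.
rewrite mulSn; lia.
Qed.
End WP.

(** A frame condition with whole arrays as units: [vs] lists the arrays that may have been
    written. *)
Definition eqoff (vs : seq nat) (s s' : store) : Prop :=
  forall a j, a \notin vs -> s' a j = s a j.

Lemma putE s a i v b j : put s a i v b j = if (b == a) && (j == i) then v else s b j.
Proof. by []. Qed.

Lemma eqoff_refl vs s : eqoff vs s s.
Proof. by []. Qed.

Lemma eqoff_put vs s s' a i v :
  a \in vs -> eqoff vs s s' -> eqoff vs s (put s' a i v).
Proof.
move=> ain h b j nin; rewrite putE (_ : b == a = false) ?h //.
by apply: contraNF nin => /eqP ->.
Qed.

Lemma eqoff_trans vs vs' s s1 s2 :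
  all (mem vs) vs' -> eqoff vs s s1 -> eqoff vs' s1 s2 -> eqoff vs s s2.
Proof.
move=> /allP sub h h' a j nin; rewrite h' ?h //.
by apply: contra nin => /sub.
Qed.

Ltac off := repeat first
  [ assumption | apply: eqoff_refl | apply: eqoff_put; [by [] |] ].

Local Notation sc v := (Get v (Const 0)).
Local Notation "v ::= e" := (Put v (Const 0) e) (at level 70).
Local Notation "P ;; Q" := (Seq P Q) (at level 75, right associativity).
Local Notation Incr v := (v ::= Add (sc v) (Const 1)).

(* Addresses 0 of the arrays 3 to 19 serve as scalar variables, except that the
   arrays 17 and 18 hold the bits of a seed and of its hash. *)
Local Notation vn := 1. Local Notation vm := 2.
Local Notation vq := 3. Local Notation vQ := 4.
Local Notation vk := 5. Local Notation vp := 6.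
Local Notation vc := 7. Local Notation vd := 8.
Local Notation vv := 9. Local Notation vS := 10.
Local Notation vi := 11. Local Notation vb := 12.
Local Notation vo := 13. Local Notation va := 14.
Local Notation vh := 15. Local Notation vl := 16.
Local Notation vA := 17. Local Notation vH := 18.
Local Notation vu := 19.

(** [up_log 2 n] with 0 replaced by 1. This is what a loop starting from exponent 1 computes, and it
    keeps the seed width positive, as the loop over blocks advances by that width. *)
Definition half_width (n : nat) : nat := (up_log 2 n).-1.+1.

(** Here and below truncated subtraction is the comparison: [Sub e f] is nonzero exactly when
    [f < e], and 1 is added to [e] to test [f <= e]. *)
Definition prog_sizes : prog :=
  vq ::= Const 2 ;; vQ ::= Const 4 ;; vk ::= Const 2 ;;
  While (Defs.Sub (sc vn) (sc vq))
    (vq ::= Add (sc vq) (sc vq) ;;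
     vQ ::= Add (Add (sc vQ) (sc vQ)) (Add (sc vQ) (sc vQ)) ;;
     vk ::= Add (sc vk) (Const 2)).

Lemma wp_sizes Z s (Phi : store -> seq gate -> Prop) :
  let r := half_width (s vn 0) in r <= Z ->
  (forall s', eqoff [:: vq; vQ; vk] s s' -> s' vQ 0 = 2 ^ (2 * r) ->
     s' vk 0 = 2 * r -> Phi s' [::]) ->
  wp Z prog_sizes s Phi.
Proof.
move=> r leZ post; do 3 (apply: wp_seq; apply: wp_put).
apply: (@wp_while Z _ _ _ _ r.-1 (fun i s' C => [/\ eqoff [:: vq; vQ; vk] s s',
  s' vq 0 = 2 ^ i.+1, s' vQ 0 = 2 ^ (2 * i.+1), s' vk 0 = 2 * i.+1 & C = [::]])).
- by apply: leq_trans (leq_pred _) leZ.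
- by split=> //; off.
- move=> i s1 C lti [E e3 e4 e5 ->]; split.
    rewrite /= e3 (E vn 0) // -lt0n subn_gt0.
    have n1 : 1 < s vn 0.
      rewrite ltnNge; apply/negP => len; move: lti.
      rewrite /r /half_width.
      by have /eqP -> : up_log 2 (s vn 0) == 0 by rewrite up_log_eq0 len.
    apply: leq_ltn_trans (up_log_gtn (ltnSn 1) n1).
    by rewrite leq_exp2l.
  do 2 (apply: wp_seq; apply: wp_put); apply: wp_put.
  split=> //; first by off.
  + by rewrite !putE /= e3 (expnS _ i.+1); lia.
  + by rewrite !putE /= !putE /= e4 !mulnS !expnD; lia.
  by rewrite !putE /= !putE /= e5; lia.
move=> s1 C [E e3 e4 e5 ->]; split; last exact: post.
rewrite /= e3 (E vn 0) //; apply/eqP; rewrite subn_eq0 /r /half_width /=.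
by apply: leq_trans (up_logP _ (ltnSn 1)) _; rewrite leq_exp2l // leqSpred.
Qed.

Definition prog_prime_test : prog :=
  vc ::= Const 0 ;; vd ::= Const 2 ;;
  While (Defs.Sub (sc vp) (sc vd))
    (vv ::= sc vp ;;
     While (Defs.Sub (Add (sc vv) (Const 1)) (sc vd)) (vv ::= Defs.Sub (sc vv) (sc vd)) ;;
     If (sc vv) Skip (vc ::= Const 1) ;;
     Incr vd).

Lemma primeNhas p : 1 < p -> prime p = ~~ has (dvdn^~ p) (iota 2 (p - 2)).
Proof.
move=> p1; apply/primeP/hasPn => [[_ h] d|h].
  rewrite mem_iota => /andP[d2 dp]; apply/negP => /h; lia.
split=> // d dvd; have dp := dvdn_leq (ltnW p1) dvd.
have d0 := dvdn_gt0 (ltnW p1) dvd.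
case: (posnP (d - 1)) => [|d1]; first by move=> ?; apply/orP; left; lia.
apply/orP; right; apply: contraT => ne.
by have := h d; rewrite mem_iota dvd => /(_ _)/negP; case; lia.
Qed.

Lemma wp_prime_test Z s (Phi : store -> seq gate -> Prop) :
  1 < s vp 0 -> s vp 0 <= Z ->
  (forall s', eqoff [:: vc; vd; vv] s s' -> s' vc 0 = ~~ prime (s vp 0) -> Phi s' [::]) ->
  wp Z prog_prime_test s Phi.
Proof.
move=> p1 leZ post; set p := s vp 0 in p1 leZ post *.
do 2 (apply: wp_seq; apply: wp_put).
apply: (@wp_while Z _ _ _ _ (p - 2) (fun i s' C => [/\ eqoff [:: vc; vd; vv] s s',
  s' vc 0 = has (dvdn^~ p) (iota 2 i), s' vd 0 = i + 2 & C = [::]])).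
- by lia.
- by split=> //; off.
- move=> i s1 C lti [E ec ed ->]; split.
    by rewrite /= ed (E vp 0) // -/p; lia.
  apply: wp_seq; apply: wp_put; rewrite /=; apply: wp_seq.
  apply: (@wp_while Z _ _ _ _ (p %/ (i + 2)) (fun j s' C => [/\ eqoff [:: vv] s1 s',
    s' vv 0 = p - j * (i + 2) & C = [::]])).
  + by apply: leq_trans (leq_div _ _) leZ.
  + by split=> //; [off|rewrite putE /= (E vp 0) // subn0].
  + move=> j s2 C2 ltj [E2 e2 ->].
    have lej : j.+1 * (i + 2) <= p.
      by apply: leq_trans (leq_trunc_div p (i + 2)); rewrite leq_mul2r ltj orbT.
    rewrite /= e2 (E2 vd 0) // ed; split; first by lia.
    apply: wp_put; split=> //; first by off.
    by rewrite putE /= e2 (E2 vd 0) // ed; lia.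
  move=> s2 C2 [E2 e2 ->].
  have em : s2 vv 0 = p %% (i + 2) by rewrite e2 {1}(divn_eq p (i + 2)) addKn.
  split; first by rewrite /= em (E2 vd 0) // ed; have := ltn_pmod p (_ : 0 < i + 2); lia.
  have E3 : eqoff [:: vc; vd; vv] s s2 by apply: eqoff_trans E E2.
  have step c : c = has (dvdn^~ p) (iota 2 i.+1) :> nat ->
      wp Z (Incr vd) (put s2 vc 0 c) (fun s3 C3 => [/\ eqoff [:: vc; vd; vv] s s3,
        s3 vc 0 = has (dvdn^~ p) (iota 2 i.+1), s3 vd 0 = i.+1 + 2 & C3 = [::]]).
    move=> ec'; apply: wp_put; split=> //; first by off.
    by rewrite !putE /= !putE /= (E2 vd 0) // ed; lia.
  have hS : has (dvdn^~ p) (iota 2 i.+1) = has (dvdn^~ p) (iota 2 i) || (i + 2 %| p).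
    by rewrite -(addn1 i) iotaD has_cat /= orbF [2 + i]addnC.
  apply: wp_seq; apply: wp_if; rewrite [Defs.eval _ _]/= em.
  case: eqP => /= e0.
    apply: wp_put; apply: step; rewrite hS /dvdn e0 eqxx orbT //.
  (* A vacuous write gives this branch the form of the other, so that [step] covers both. *)
  apply: wp_skip; have -> : s2 = put s2 vc 0 (s2 vc 0).
    apply/boolp.funext => a; apply/boolp.funext => j; rewrite putE.
    by case: andP => // -[/eqP -> /eqP ->].
  apply: step; rewrite (E2 vc 0) // ec hS /dvdn; case: eqP => // _.
  by rewrite orbF.
move=> s1 C [E ec ed ->]; split; last by apply: post; rewrite // ec primeNhas // negbK.
by rewrite /= ed (E vp 0) // -/p; lia.
Qed.

Definition prog_next_prime : prog :=
  vp ::= sc vQ ;; vc ::= Const 1 ;;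
  While (sc vc) (Incr vp ;; prog_prime_test).

Lemma wp_next_prime Z s (Phi : store -> seq gate -> Prop) :
  0 < s vQ 0 -> next_prime (s vQ 0) <= Z ->
  (forall s', eqoff [:: vp; vc; vd; vv] s s' -> s' vp 0 = next_prime (s vQ 0) ->
     Phi s' [::]) ->
  wp Z prog_next_prime s Phi.
Proof.
move=> Q0 leZ post; set Q := s vQ 0 in Q0 leZ post *.
have gtQ := next_prime_gt Q.
do 2 (apply: wp_seq; apply: wp_put).
(* The flag starts at 1 without any test, whence the disjunct [i == 0]: [Q] itself is skipped
   because the prime must exceed it. *)
apply: (@wp_while Z _ _ _ _ (next_prime Q - Q) (fun i s' C =>
  [/\ eqoff [:: vp; vc; vd; vv] s s',
  s' vp 0 = Q + i, s' vc 0 = (i == 0) || ~~ prime (Q + i) & C = [::]])).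
- by lia.
- by split=> //; [off | rewrite !putE /= addn0].
- move=> i s1 C lti [E ep ec ->]; split.
    rewrite /= ec; case: (posnP i) => [->|i0] //.
    case: (boolP (prime (Q + i))) => [pr|_]; last by rewrite orbT.
    by have := @next_prime_min Q (Q + i) pr; lia.
  apply: wp_seq; apply: wp_put; rewrite /= ep.
  apply: wp_prime_test; rewrite putE /=; try lia.
  move=> s2 E2 e2; split=> //.
  + by apply: eqoff_trans E2 => //; off.
  + by rewrite (E2 vp 0) // putE /=; lia.
  by rewrite e2 addn1 addnS.
move=> s1 C [E ep ec ->]; have eN : Q + (next_prime Q - Q) = next_prime Q by lia.
split; last by apply: post; rewrite ?ep.
by rewrite /= ec eN next_prime_prime orbF; apply/eqP; rewrite eqb0; lia.
Qed.

(** With [k] seed bits, [k + k + 4] bits hold every residue, by [next_prime_ltn]. *)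
Local Notation out_width := (Add (Add (sc vk) (sc vk)) (Const 4)).
Local Notation block_width := (Add (sc vk) out_width).

(** Division by repeated addition: [vu] stays one block ahead, and the loop ends when that block no
    longer fits into [m]. *)
Definition prog_seed_bits : prog :=
  vS ::= Const 0 ;; vu ::= block_width ;;
  While (Defs.Sub (Add (sc vm) (Const 1)) (sc vu))
    (vu ::= Add (sc vu) block_width ;; vS ::= Add (sc vS) (sc vk)).

Lemma wp_seed_bits Z s (Phi : store -> seq gate -> Prop) :
  s vm 0 <= Z ->
  (forall s', eqoff [:: vS; vu] s s' ->
     s' vS 0 = s vk 0 * (s vm 0 %/ (s vk 0 + (s vk 0 + s vk 0 + 4))) -> Phi s' [::]) ->
  wp Z prog_seed_bits s Phi.
Proof.
set k := s vk 0; set W := k + (k + k + 4) => leZ post.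
do 2 (apply: wp_seq; apply: wp_put).
apply: (@wp_while Z _ _ _ _ (s vm 0 %/ W) (fun i s' C => [/\ eqoff [:: vS; vu] s s',
  s' vu 0 = i.+1 * W, s' vS 0 = k * i & C = [::]])).
- exact: leq_trans (leq_div _ _) leZ.
- split=> //; first by off.
    by rewrite !putE /= !putE /= mul1n.
  by rewrite !putE /= muln0.
- move=> i s1 C lti [E eu eS ->].
  have lei : i.+1 * W <= s vm 0.
    by apply: leq_trans (leq_trunc_div _ W); rewrite leq_mul2r lti orbT.
  rewrite /= eu (E vm 0) //; split; first by lia.
  apply: wp_seq; apply: wp_put; apply: wp_put; split=> //; first by off.
    by rewrite !putE /= eu (E vk 0) // -/k -/W; lia.
  by rewrite !putE /= !putE /= eS (E vk 0) // -/k; lia.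
move=> s1 C [E eu eS ->]; split; last by apply: post.
rewrite /= eu (E vm 0) //; have := ltn_ceil (s vm 0) (_ : 0 < W); rewrite /W; lia.
Qed.

Definition prog_hadamards : prog :=
  vi ::= Const 0 ;;
  While (Defs.Sub (sc vS) (sc vi)) (Apply (ApplyH (sc vi)) ;; Incr vi).

Lemma wp_hadamards Z s (Phi : store -> seq gate -> Prop) :
  s vS 0 <= Z ->
  (forall s', eqoff [:: vi] s s' -> Phi s' (map GateH (iota 0 (s vS 0)))) ->
  wp Z prog_hadamards s Phi.
Proof.
move=> leZ post; apply: wp_seq; apply: wp_put.
apply: (@wp_while Z _ _ _ _ (s vS 0) (fun i s' C => [/\ eqoff [:: vi] s s',
  s' vi 0 = i & C = map GateH (iota 0 i)])) => //.
- by split=> //; off.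
- move=> i s1 C lti [E ei ->]; rewrite /= ei (E vS 0) //; split; first by lia.
  apply: wp_seq; apply: wp_apply; apply: wp_put; split; first by off.
    by rewrite !putE /= ei addn1.
  have -> : GateH 0 :: map GateH (iota 1 i) = map GateH (iota 0 i) ++ [:: GateH i].
    by rewrite -[RHS](map_cat GateH _ [:: i]) -[_ ++ [:: i]](iotaD 0 i 1) addn1.
  by rewrite /= ei.
move=> s1 C [E ei ->]; rewrite /= ei (E vS 0) // subnn; split=> //; exact: post.
Qed.

Definition prog_flip : prog :=
  Apply (ApplyH (sc vm)) ;; Apply (ApplyT (sc vm)) ;; Apply (ApplyT (sc vm)) ;;
  Apply (ApplyT (sc vm)) ;; Apply (ApplyT (sc vm)) ;; Apply (ApplyH (sc vm)).

Lemma wp_flip Z s (Phi : store -> seq gate -> Prop) :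
  Phi s (flip (s vm 0)) -> wp Z prog_flip s Phi.
Proof. by move=> h; do 5 (apply: wp_seq; apply: wp_apply); apply: wp_apply. Qed.

(** The product by the seed is a repeated addition. Both summands are below [p], so one conditional
    subtraction reduces each sum. *)
Definition prog_hash : prog :=
  vh ::= Const 0 ;; vi ::= Const 0 ;;
  While (Defs.Sub (sc vn) (sc vi))
    (vv ::= Get 0 (sc vi) ;; vl ::= Const 0 ;;
     While (Defs.Sub (sc va) (sc vl))
       (vv ::= Add (sc vv) (sc vh) ;;
        If (Defs.Sub (Add (sc vv) (Const 1)) (sc vp))
           (vv ::= Defs.Sub (sc vv) (sc vp)) Skip ;;
        Incr vl) ;;
     vh ::= sc vv ;; Incr vi).

Lemma wp_hash Z s x (Phi : store -> seq gate -> Prop) :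
  size x = s vn 0 -> (forall i, s 0 i = nth false x i) -> 1 < s vp 0 ->
  s vn 0 <= Z -> s va 0 <= Z ->
  (forall s', eqoff [:: vh; vi; vv; vl] s s' ->
     s' vh 0 = poly_hash (s vp 0) x (s va 0) -> Phi s' [::]) ->
  wp Z prog_hash s Phi.
Proof.
set p := s vp 0; set a := s va 0; move=> szx ex p1 leZ leZ' post.
do 2 (apply: wp_seq; apply: wp_put).
apply: (@wp_while Z _ _ _ _ (s vn 0) (fun i s' C => [/\ eqoff [:: vh; vi; vv; vl] s s',
  s' vh 0 = poly_hash p (take i x) a, s' vi 0 = i & C = [::]])) => //.
- by rewrite take0; split=> //; off.
- move=> i s1 C lti [E eh ei ->]; rewrite /= ei (E vn 0) //; split; first by lia.
  set h := poly_hash _ _ _ in eh; have lth : h < p by apply: poly_hash_ltn; lia.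
  do 2 (apply: wp_seq; apply: wp_put); apply: wp_seq.
  rewrite /= ei (E 0 i) // ex.
  apply: (@wp_while Z _ _ _ _ a (fun j s' C => [/\ eqoff [:: vv; vl] s1 s',
    s' vv 0 = (nth false x i + j * h) %% p, s' vl 0 = j & C = [::]])) => //.
  + split=> //; first by off.
    by rewrite !putE /= mul0n addn0 modn_small //; case: nth => //; lia.
  + move=> j s2 C2 ltj [E2 ev el ->]; rewrite /= el (E2 va 0) // (E va 0) //.
    split; first by rewrite -/a; lia.
    apply: wp_seq; apply: wp_put; apply: wp_seq; apply: wp_if.
    rewrite /= !putE /= ev (E2 vh 0) // eh (E2 vp 0) // (E vp 0) // -/p.
    have := ltn_pmod (nth false x i + j * h) (ltnW p1); set u := _ %% p => ltu.
    have eu : (nth false x i + j.+1 * h) %% p = (u + h) %% p.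
      by rewrite /u modnDml mulSn; congr (_ %% p); lia.
    case: ifPn => hc.
      apply: wp_put; rewrite /= !putE /= (E2 vp 0) // (E vp 0) // -/p.
      apply: wp_put; split=> //; first by off.
        rewrite !putE /= eu -[u + h in RHS](@subnK p); last by lia.
        by rewrite modnDr modn_small //; lia.
      by rewrite !putE /= !putE /= el addn1.
    apply: wp_skip; apply: wp_put; split=> //; first by off.
      by rewrite !putE /= eu modn_small //; lia.
    by rewrite !putE /= !putE /= el addn1.
  move=> s2 C2 [E2 ev el ->]; rewrite /= el (E2 va 0) // (E va 0) // subnn.
  split=> //; apply: wp_seq; apply: wp_put; apply: wp_put; split=> //.
  + by off; apply: eqoff_trans E2.
  + rewrite !putE /= ev (take_nth false) ?szx // /poly_hash foldl_rcons.
    by rewrite mulnC.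
  by rewrite !putE /= !putE /= (E2 vi 0) // ei addn1.
move=> s1 C [E eh ei ->]; rewrite /= ei (E vn 0) // subnn; split=> //.
by apply: post; rewrite // eh -szx take_size.
Qed.

(** Subtracting 2 while more than 1 is left halves a number: the remainder is the next bit, and the
    count in [vu] is the half. *)
Definition prog_bits (src dst : nat) (len : expr) : prog :=
  vv ::= sc src ;; vi ::= Const 0 ;;
  While (Defs.Sub len (sc vi))
    (vu ::= Const 0 ;;
     While (Defs.Sub (sc vv) (Const 1))
       (vv ::= Defs.Sub (sc vv) (Const 2) ;; Incr vu) ;;
     Put dst (sc vi) (sc vv) ;; vv ::= sc vu ;; Incr vi).

Lemma wp_bits Z s src dst len L (Phi : store -> seq gate -> Prop) :
  dst \notin [:: vv; vi; vu] ->
  (forall s', eqoff [:: vv; vi; vu; dst] s s' -> Defs.eval s' len = L) ->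
  L <= Z -> s src 0 <= Z ->
  (forall s', eqoff [:: vv; vi; vu; dst] s s' ->
     (forall j, j < L -> s' dst j = qbit (s src 0) j) -> Phi s' [::]) ->
  wp Z (prog_bits src dst len) s Phi.
Proof.
rewrite !inE !negb_or => /and3P[/negPf nv /negPf ni /negPf nu] hlen leL leZ post.
have ni' : vi == dst = false by rewrite eq_sym.
have nu' : vu == dst = false by rewrite eq_sym.
set v := s src 0 in leZ post *.
have memd : dst \in [:: vv; vi; vu; dst] by rewrite !inE eqxx !orbT.
do 2 (apply: wp_seq; apply: wp_put).
apply: (@wp_while Z _ _ _ _ L (fun i s' C => [/\ eqoff [:: vv; vi; vu; dst] s s',
  s' vv 0 = v %/ 2 ^ i, s' vi 0 = i, (forall j, j < i -> s' dst j = qbit v j)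
  & C = [::]])) => //.
- by split=> //; [off | rewrite !putE /= divn1].
- move=> i s1 C lti [E ev ei ed ->]; rewrite /= ei (hlen s1 E); split; first by lia.
  apply: wp_seq; apply: wp_put; apply: wp_seq.
  set V := v %/ 2 ^ i in ev.
  apply: (@wp_while Z _ _ _ _ V./2 (fun j s' C => [/\ eqoff [:: vv; vu] s1 s',
    s' vv 0 = V - j.*2, s' vu 0 = j & C = [::]])) => //.
  + by have := leq_div v (2 ^ i); rewrite -/V; lia.
  + by split=> //; [off | rewrite !putE /= subn0].
  + move=> j s2 C2 ltj [E2 e2 eu ->]; rewrite /= e2; split; first by lia.
    apply: wp_seq; apply: wp_put; apply: wp_put; split=> //; first by off.
      by rewrite !putE /= e2; lia.
    by rewrite !putE /= !putE /= eu; lia.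
  move=> s2 C2 [E2 e2 eu ->]; rewrite /= e2; split; first by lia.
  apply: wp_seq; apply: wp_put; apply: wp_seq; apply: wp_put; apply: wp_put.
  rewrite /= !putE /= ni' nu' /= (E2 vi 0) // ei eu e2.
  split=> //.
  + by off; apply: eqoff_trans E2.
  + by rewrite expnS mulnC divnMA divn2.
  + by rewrite addn1.
  move=> j ltj; rewrite !putE ni nv /= eqxx /=.
  case: eqP => [->|ne]; first by rewrite qbitE -/V; have := odd_double_half V; lia.
  rewrite (E2 dst j) ?ed //; first by lia.
  by rewrite !inE nv nu.
move=> s1 C [E ev ei ed ->]; rewrite /= ei (hlen s1 E) subnn; split=> //; exact: post.
Qed.

(** Convertible to the concatenations in the circuit definitions, but protected from simplification
    in loop invariants. *)
Definition steps (f : nat -> seq gate) (n : nat) : seq gate :=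
  flatten [seq f i | i <- iota 0 n].
Arguments steps : simpl never.

Lemma stepsS f n : steps f n.+1 = steps f n ++ f n.
Proof. by rewrite /steps -(addn1 n) iotaD map_cat flatten_cat /= cats0. Qed.

Definition prog_chain_step : prog :=
  Apply (ApplyToffoli (Add (sc vm) (sc vi)) (Add (sc vb) (sc vi))
                      (Add (sc vm) (Add (sc vi) (Const 1)))) ;;
  If (Get vA (sc vi)) Skip
     (Apply (ApplyCNOT (Add (sc vm) (sc vi)) (Add (sc vm) (Add (sc vi) (Const 1))))).

Lemma wp_chain_step Z s a (Phi : store -> seq gate -> Prop) :
  s vA (s vi 0) = qbit a (s vi 0) ->
  Phi s (chain_step (s vm 0) (s vb 0) a (s vi 0)) -> wp Z prog_chain_step s Phi.
Proof.
move=> ea post; apply: wp_seq; apply: wp_apply; apply: wp_if; rewrite /= ea.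
move: post; rewrite /chain_step -(addn1 (s vi 0)).
by case: (qbit _ _) => h; [apply: wp_skip | apply: wp_apply].
Qed.

Definition prog_lookup : prog :=
  vi ::= Const 0 ;;
  While (Defs.Sub (sc vk) (sc vi)) (prog_chain_step ;; Incr vi) ;;
  vi ::= Const 0 ;;
  While (Defs.Sub out_width (sc vi))
    (If (Get vH (sc vi))
        (Apply (ApplyCNOT (Add (sc vm) (sc vk)) (Add (sc vo) (sc vi)))) Skip ;;
     Incr vi) ;;
  vi ::= sc vk ;;
  While (sc vi) (vi ::= Defs.Sub (sc vi) (Const 1) ;; prog_chain_step).

Lemma wp_lookup Z s a h (Phi : store -> seq gate -> Prop) :
  let k := s vk 0 in let w := k + k + 4 in w <= Z ->
  (forall j, j < k -> s vA j = qbit a j) -> (forall j, j < w -> s vH j = qbit h j) ->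
  (forall s', eqoff [:: vi] s s' ->
     Phi s' (lookup k w (s vm 0) (s vb 0) (s vo 0) a h)) ->
  wp Z prog_lookup s Phi.
Proof.
move=> k w leZ ha hh post; have lekZ : k <= Z by lia.
apply: wp_seq; apply: wp_put; apply: wp_seq.
apply: (@wp_while Z _ _ _ _ k (fun i s' C => [/\ eqoff [:: vi] s s',
  s' vi 0 = i & C = steps (chain_step (s vm 0) (s vb 0) a) i])) => //.
- by split=> //; off.
- move=> i s1 C lti [E ei ->]; split; first by rewrite /= ei (E vk 0) // -/k; lia.
  apply: wp_seq; apply: (@wp_chain_step _ _ a); first by rewrite ei (E vA i) // ha.
  apply: wp_put; split; first by off.
    by rewrite !putE /= ei addn1.
  by rewrite stepsS ei (E vm 0) // (E vb 0) // cats0.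
move=> s1 C1 [E1 e1 ->]; split; first by rewrite /= e1 (E1 vk 0) // subnn.
apply: wp_seq; apply: wp_put; apply: wp_seq.
apply: (@wp_while Z _ _ _ _ w (fun i s' C => [/\ eqoff [:: vi] s s',
  s' vi 0 = i & C = steps (copy_step (s vm 0 + k) (s vo 0) h) i])) => //.
- by split=> //; off.
- move=> i s2 C lti [E ei ->]; split; first by rewrite /= ei (E vk 0) // -/k; lia.
  apply: wp_seq; apply: wp_if; rewrite [Defs.eval _ _]/= ei (E vH i) // hh //.
  have -> : (nat_of_bool (qbit h i) != 0) = qbit h i by case: qbit.
  have inc C' : C' = copy_step (s vm 0 + k) (s vo 0) h i ->
      wp Z (Incr vi) s2 (fun s3 C3 => [/\ eqoff [:: vi] s s3, s3 vi 0 = i.+1 &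
        steps (copy_step (s vm 0 + k) (s vo 0) h) i ++ C' ++ C3 =
        steps (copy_step (s vm 0 + k) (s vo 0) h) i.+1]).
    move=> ->; apply: wp_put; split; first by off.
      by rewrite !putE /= ei addn1.
    by rewrite stepsS cats0.
  case: ifP => hi; [apply: wp_apply | apply: wp_skip]; apply: inc.
    by rewrite /copy_step hi /= (E vm 0) // (E vk 0) // (E vo 0) // ei.
  by rewrite /copy_step hi.
move=> s2 C2 [E2 e2 ->]; split; first by rewrite /= e2 (E2 vk 0) // -/k; lia.
apply: wp_seq; apply: wp_put; rewrite /= (E2 vk 0) // -/k.
apply: (@wp_while Z _ _ _ _ k (fun i s' C => [/\ eqoff [:: vi] s s',
  s' vi 0 = k - i &
  C = steps (fun i => chain_step (s vm 0) (s vb 0) a (k - i.+1)) i])) => //.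
- by split=> //; [off | rewrite !putE /= subn0].
- move=> i s3 C lti [E ei ->]; split; first by rewrite /= ei; lia.
  apply: wp_seq; apply: wp_put.
  have ej : put s3 vi (Defs.eval s3 (Const 0))
      (Defs.eval s3 (Defs.Sub (sc vi) (Const 1))) vi 0 = k - i.+1.
    by rewrite !putE /= ei; lia.
  apply: (@wp_chain_step _ _ a); rewrite ej ?putE /= ?(E vA) // ?ha //; first by lia.
  split; [off | by rewrite ?ej |].
  by rewrite stepsS (E vm 0) // (E vb 0).
move=> s3 C3 [E3 e3 ->]; split; first by rewrite /= e3 subnn.
exact: post.
Qed.

Definition prog_table : prog :=
  va ::= Const 0 ;;
  While (Defs.Sub (sc vQ) (sc va))
    (prog_hash ;; prog_bits va vA (sc vk) ;; prog_bits vh vH out_width ;;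
     prog_lookup ;; Incr va).

Definition table_vars : seq nat := [:: va; vh; vi; vv; vl; vu; vA; vH].

Lemma wp_table Z s x (Phi : store -> seq gate -> Prop) :
  let k := s vk 0 in let w := k + k + 4 in let p := s vp 0 in
  size x = s vn 0 -> (forall i, s 0 i = nth false x i) -> 1 < p -> s vQ 0 = 2 ^ k ->
  w <= Z -> p <= Z -> 2 ^ k <= Z -> s vn 0 <= Z ->
  (forall s', eqoff table_vars s s' ->
     Phi s' (lookup_table k w (s vm 0) (s vb 0) (s vo 0) (poly_hash p x))) ->
  wp Z prog_table s Phi.
Proof.
move=> k w p szx ex p1 eQ wZ pZ QZ nZ post.
apply: wp_seq; apply: wp_put.
apply: (@wp_while Z _ _ _ _ (2 ^ k) (fun i s' C => [/\ eqoff table_vars s s',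
  s' va 0 = i & C = steps (fun a =>
    lookup k w (s vm 0) (s vb 0) (s vo 0) a (poly_hash p x a)) i])) => //.
- by split=> //; off.
- move=> i s1 C lti [E ei ->]; split; first by rewrite /= ei (E vQ 0) // eQ; lia.
  have hZ : poly_hash p x i <= Z by apply: leq_trans (ltnW (poly_hash_ltn _ _ _)) pZ; lia.
  apply: wp_seq; apply: (@wp_hash _ _ x); rewrite ?(E vn 0) ?(E vp 0) ?ei //.
  + by move=> j; rewrite (E 0 j).
  + by lia.
  rewrite -/p => s2 E1 eh.
  have E2 : eqoff table_vars s s2 by apply: eqoff_trans E E1.
  have e2 : s2 va 0 = i by rewrite (E1 va 0).
  apply: wp_seq; apply: (@wp_bits _ _ _ _ _ k) => //.
  + by move=> s' E'; rewrite /= (E' vk 0) // (E2 vk 0).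
  + by lia.
  + by rewrite e2; lia.
  rewrite e2 => s3 E3' eA.
  have E3 : eqoff table_vars s s3 by apply: eqoff_trans E2 E3'.
  have e3 : s3 va 0 = i by rewrite (E3' va 0).
  have eh3 : s3 vh 0 = poly_hash p x i by rewrite (E3' vh 0).
  apply: wp_seq; apply: (@wp_bits _ _ _ _ _ w) => //.
  + by move=> s' E'; rewrite /= (E' vk 0) // (E3 vk 0).
  + by rewrite eh3.
  rewrite eh3 => s4 E4' eH.
  have E4 : eqoff table_vars s s4 by apply: eqoff_trans E3 E4'.
  have e4 : s4 va 0 = i by rewrite (E4' va 0).
  apply: wp_seq; apply: (@wp_lookup _ _ i (poly_hash p x i)); rewrite ?(E4 vk 0) //.
  + by move=> j ltj; rewrite (E4' vA j) // eA.
  move=> s5 E5'.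
  have E5 : eqoff table_vars s s5 by apply: eqoff_trans E4 E5'.
  apply: wp_put; split; first by off.
    by rewrite !putE /= (E5' va 0) // e4 addn1.
  by rewrite stepsS /= cats0 (E4 vm 0) // (E4 vb 0) // (E4 vo 0).
move=> s1 C [E ei ->]; split; first by rewrite /= ei (E vQ 0) // eQ subnn.
exact: post.
Qed.

Definition prog_blocks : prog :=
  vb ::= Const 0 ;; vo ::= sc vS ;;
  While (Defs.Sub (sc vS) (sc vb))
    (prog_table ;; vb ::= Add (sc vb) (sc vk) ;; vo ::= Add (sc vo) out_width).

Lemma wp_blocks Z s x t (Phi : store -> seq gate -> Prop) :
  let k := s vk 0 in let w := k + k + 4 in let p := s vp 0 in
  size x = s vn 0 -> (forall i, s 0 i = nth false x i) -> 1 < p -> s vQ 0 = 2 ^ k ->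
  w <= Z -> p <= Z -> 2 ^ k <= Z -> s vn 0 <= Z -> t <= Z -> 0 < k -> s vS 0 = k * t ->
  (forall s', eqoff (vb :: vo :: table_vars) s s' ->
     Phi s' (steps (fun j => lookup_table k w (s vm 0) (k * j) (k * t + w * j)
                               (poly_hash p x)) t)) ->
  wp Z prog_blocks s Phi.
Proof.
move=> k w p szx ex p1 eQ wZ pZ QZ nZ tZ k0 eS post.
do 2 (apply: wp_seq; apply: wp_put).
apply: (@wp_while Z _ _ _ _ t (fun i s' C => [/\ eqoff (vb :: vo :: table_vars) s s',
  s' vb 0 = k * i, s' vo 0 = k * t + w * i & C = steps (fun j =>
    lookup_table k w (s vm 0) (k * j) (k * t + w * j) (poly_hash p x)) i])) => //.
- by split=> //; [off | rewrite !putE /= muln0 | rewrite !putE /= !putE /= eS; lia].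
- move=> i s1 C lti [E eb eo ->]; split.
    by rewrite /= eb (E vS 0) // eS -lt0n subn_gt0 ltn_pmul2l.
  apply: wp_seq; apply: (@wp_table _ _ x);
    rewrite ?(E vn 0) ?(E vp 0) ?(E vQ 0) ?(E vk 0) //.
  + by move=> j; rewrite (E 0 j).
  move=> s2 E2'.
  have E2 : eqoff (vb :: vo :: table_vars) s s2 by apply: eqoff_trans E E2'.
  apply: wp_seq; apply: wp_put; apply: wp_put; split; first by off.
  + by rewrite !putE /= (E2' vb 0) // eb (E2 vk 0) // -/k; lia.
  + by rewrite !putE /= !putE /= (E2' vo 0) // eo (E2 vk 0) // -/k -/w; lia.
  by rewrite stepsS /= cats0 (E vm 0) // eb eo.
move=> s1 C [E eb eo ->]; split; first by rewrite /= eb (E vS 0) // eS subnn.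
exact: post.
Qed.

Definition prog_fingerprint : prog :=
  prog_sizes ;; prog_next_prime ;; prog_seed_bits ;; prog_hadamards ;; prog_flip ;;
  prog_blocks ;; prog_flip.

Lemma wp_fingerprint Z n m (x : n.-tuple bool) :
  let k := 2 * half_width n in let w := k + k + 4 in let p := next_prime (2 ^ k) in
  n <= Z -> m <= Z -> p <= Z -> w <= Z ->
  wp Z prog_fingerprint (input_store m x)
    (fun _ C => C = hash_circuit k w m (m %/ (k + w)) (poly_hash p x)).
Proof.
move=> k w p nZ mZ pZ wZ.
have QZ : 2 ^ k <= Z by apply: leq_trans pZ; apply/ltnW/next_prime_gt.
have k0 : 0 < k by rewrite /k /half_width.
apply: wp_seq; apply: wp_sizes => [|s1 E1]; rewrite /= -/k; first by lia.
move=> eQ ek; apply: wp_seq; apply: wp_next_prime; rewrite ?eQ ?expn_gt0 //.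
move=> s2 E2 ep; apply: wp_seq; apply: wp_seed_bits.
  by rewrite (E2 vm 0) // (E1 vm 0).
rewrite (E2 vk 0) // ek (E2 vm 0) // (E1 vm 0) // -/w => s3 E3 eS.
have ktZ : k * (m %/ (k + w)) <= Z.
  apply: leq_trans mZ; apply: leq_trans (leq_trunc_div m (k + w)).
  by rewrite mulnC leq_mul2l leq_addr orbT.
apply: wp_seq; apply: wp_hadamards; first by rewrite eS.
move=> s4 E4; apply: wp_seq; apply: wp_flip; apply: wp_seq.
have in4 a j : a \in [:: 0; 1; 2] -> s4 a j = input_store m x a j.
  rewrite !inE => /or3P[] /eqP ->;
    by rewrite (E4 _ j) // (E3 _ j) // (E2 _ j) // (E1 _ j).
have ek4 : s4 vk 0 = k by rewrite (E4 vk 0) // (E3 vk 0) // (E2 vk 0).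
have ep4 : s4 vp 0 = p by rewrite (E4 vp 0) // (E3 vp 0).
apply: (@wp_blocks _ _ x (m %/ (k + w))); rewrite ?ek4 ?ep4 ?(in4 1) ?(in4 2) //.
- by rewrite size_tuple.
- by move=> j; rewrite in4.
- exact/prime_gt1/next_prime_prime.
- by rewrite (E4 vQ 0) // (E3 vQ 0) // (E2 vQ 0).
- exact: leq_trans (leq_div _ _) mZ.
- by rewrite (E4 vS 0).
move=> s5 E5; apply: wp_flip; rewrite (E5 vm 0) // in4 //= eS.
by [].
Qed.

(** * The hash functions *)

Lemma leq_half_width n : n <= 2 ^ half_width n.
Proof.
by apply: leq_trans (up_logP n (ltnSn 1)) _; rewrite leq_exp2l // leqSpred.
Qed.

Lemma expn_half_width_leq n : 2 ^ half_width n <= 2 * n.+1.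
Proof.
rewrite /half_width expnS leq_mul2l /=; case: (ltnP 1 n) => [n1|n1].
  by apply/ltnW/(leq_trans (up_log_gtn _ n1)).
by have /eqP -> : up_log 2 n == 0 by rewrite up_log_eq0 n1.
Qed.

Section Fingerprint.
Variables (R : realType) (m : nat -> nat).
Local Open Scope classical_set_scope.
Local Open Scope ring_scope.
Local Open Scope complex_scope.

Let k n := (2 * half_width n)%N.
Let w n := (k n + k n + 4)%N.
Let p n := next_prime (2 ^ k n).
Let t n := (m n %/ (k n + w n))%N.

Definition fingerprint n (x : n.-tuple bool) : 'cV[R[i]]_(2 ^ m n) :=
  hash_state R (k n) (w n) (m n) (t n) (poly_hash (p n) x).

Let tP n : ((k n + w n) * t n <= m n)%N.
Proof. by rewrite mulnC; apply: leq_trunc_div. Qed.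

Let w0 n : (0 < w n)%N. Proof. by rewrite /w addn4. Qed.

Let hashP n (x : n.-tuple bool) a : (poly_hash (p n) x a < 2 ^ w n)%N.
Proof.
apply: leq_ltn_trans (next_prime_ltn (k n)).
by apply/ltnW/poly_hash_ltn/prime_gt0/next_prime_prime.
Qed.

Lemma dotc_fingerprint n (x : n.-tuple bool) :
  dotc (fingerprint x) (fingerprint x) = 1.
Proof.
rewrite dotc_hash_state //.
rewrite (@eq_count _ _ predT) => [|a]; last by rewrite /= eqxx.
by rewrite count_predT size_iota natrX divff ?expr1n // expf_neq0 ?pnatr_eq0.
Qed.

Lemma max_overlap_fingerprint n :
  max_overlap (@fingerprint n) <= (n%:R / 2 ^+ k n) ^+ t n.
Proof.
apply/bigmax_leP; split=> [|[x y] /= ne].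
  by rewrite exprn_ge0 // divr_ge0 // exprn_ge0.
rewrite dotc_hash_state //= expr0n addr0 sqrtr_sqr ger0_norm.
  apply: lerXn2r; rewrite ?nnegrE ?divr_ge0 ?exprn_ge0 //.
  rewrite ler_pM2r ?invr_gt0 ?exprn_gt0 // ler_nat -[leqRHS](size_tuple x).
  apply: poly_hash_collisions; rewrite ?next_prime_prime ?size_tuple //.
    exact/ltnW/next_prime_gt.
  by move/val_inj => e; rewrite e eqxx in ne.
by rewrite exprn_ge0 // divr_ge0 // exprn_ge0.
Qed.

(** The factor 2 in the seed width gives [n * n <= 2 ^ k n], so each block contributes at most
    [n^-1]. *)
Lemma max_overlap_fingerprint_le n : (0 < n)%N ->
  max_overlap (@fingerprint n) <= n%:R `^ (- (t n)%:R).
Proof.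
move=> n0; apply: le_trans (max_overlap_fingerprint n) _.
rewrite powRN powR_mulrn // -[leRHS]exprVn; apply: lerXn2r.
- by rewrite nnegrE divr_ge0 // exprn_ge0.
- by rewrite nnegrE invr_ge0.
rewrite ler_pdivrMr ?exprn_gt0 // mulrC ler_pdivlMr ?ltr0n //.
rewrite -natrX -natrM ler_nat /k mul2n -addnn expnD.
by apply: leq_mul; apply: leq_half_width.
Qed.

Lemma log2_ge1 n : (1 < n)%N -> 1 <= log2 (n%:R : R).
Proof.
move=> n1; rewrite /log2 ler_pdivlMr ?mul1r ?ln_gt0 ?ltr1n //.
by rewrite ler_ln ?posrE ?ltr0n ?ler_nat // ltnW.
Qed.

Lemma powR2_log2 n (c : R) : (0 < n)%N -> 2 `^ (c * log2 n%:R) = n%:R `^ c.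
Proof.
move=> n0; rewrite /powR !pnatr_eq0 /= (gtn_eqF n0) /log2; congr expR.
have : ln 2 != 0 :> R by rewrite gt_eqF // ln_gt0 // ltr1n.
by move=> nz; field.
Qed.

Lemma block_width_le n : (1 < n)%N -> (k n + w n)%:R <= 16 * log2 (n%:R : R).
Proof.
move=> n1; have := log2_ge1 n1.
have : (half_width n)%:R <= log2 (n%:R : R) + 1.
  rewrite /half_width -natr1 lerD2r /log2 ler_pdivlMr ?ln_gt0 ?ltr1n //.
  rewrite mulr_natl -lnXn ?ltr0n // ler_ln ?posrE ?exprn_gt0 ?ltr0n //; last exact: ltnW.
  by rewrite -natrX ler_nat ltnW // up_log_gtn.
(* The width is [6 * half_width n + 4], at most [6 * log2 n + 10]; since [log2 n] is at least 1,
   this gives the constant 16. *)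
rewrite /w /k !natrD natrM; lra.
Qed.

Lemma negligible_max_overlap :
  ((m n)%:R / log2 (n%:R : R) @[n --> \oo] --> +oo) ->
  Defs.negligible (fun n => max_overlap (@fingerprint n)).
Proof.
move=> /cvgryPge hm c c0.
near=> n.
have n1 : (1 < n)%N by near: n; exists 2%N.
have l0 : 0 < log2 (n%:R : R) by rewrite (lt_le_trans ltr01) // log2_ge1.
apply: le_trans (max_overlap_fingerprint_le (ltnW n1)) _.
apply: ler_powR; first by rewrite ler1n ltnW.
rewrite lerN2.
(* The factor 16 pays for the block width, and the added 2 absorbs the rounding in [t n], of which
   only [t n + 1 > c + 2] is known. *)
have : 16 * (c + 2) <= (m n)%:R / log2 (n%:R : R) by near: n; apply: hm.
rewrite ler_pdivlMr // => hmn.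
have W0 : (0 < k n + w n)%N by rewrite addn_gt0 w0 orbT.
have := ltn_ceil (m n) W0; rewrite -/(t n) -(ltr_nat R) natrM -natr1 => lt.
have h : (c + 2) * (k n + w n)%:R <= (m n)%:R.
  apply: le_trans hmn; rewrite [leRHS]mulrAC [leRHS]mulrC ler_wpM2l //; first lra.
  exact: block_width_le.
have := le_lt_trans h lt; rewrite ltr_pM2r ?ltr0n //; lra.
Unshelve. all: by end_near.
Qed.

Lemma negligible_powR2 (l : nat -> R) :
  ((n%:R - l n) / log2 (n%:R : R) @[n --> \oo] --> +oo) ->
  Defs.negligible (fun n => 2 `^ (l n - n%:R)).
Proof.
move=> /cvgryPge hl c c0; near=> n.
have n1 : (1 < n)%N by near: n; exists 2%N.
have l0 : 0 < log2 (n%:R : R) by rewrite (lt_le_trans ltr01) // log2_ge1.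
rewrite -(powR2_log2 _ (ltnW n1)); apply: ler_powR; first by rewrite ler1n.
have : c <= (n%:R - l n) / log2 (n%:R : R) by near: n; apply: hl.
rewrite ler_pdivlMr // mulNr; lra.
Unshelve. all: by end_near.
Qed.

Lemma negligible_add (f g : nat -> R) :
  Defs.negligible f -> Defs.negligible g -> Defs.negligible (fun n => f n + g n).
Proof.
(* The spare factor [n^-1] absorbs the 2 from the two summands once [n >= 2]. *)
move=> hf hg c c0; have c1 : 0 < c + 1 by lra.
near=> n.
have n1 : (1 < n)%N by near: n; exists 2%N.
have n0 : n%:R != 0 :> R by rewrite pnatr_eq0 -lt0n ltnW.
have lf : f n <= n%:R `^ (- (c + 1)) by near: n; apply: hf.
have lg : g n <= n%:R `^ (- (c + 1)) by near: n; apply: hg.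
apply: le_trans (lerD lf lg) _.
rewrite opprD powRD ?n0 ?implybT // powR_inv1 // -mulrDr.
rewrite ler_piMr ?powR_ge0 // -mulr2n -[_ *+ 2]mulr_natl ler_pdivrMr ?ltr0n 1?ltnW //.
by rewrite mul1r ler_nat.
Unshelve. all: by end_near.
Qed.

Lemma negligible_le (f g : nat -> R) :
  (forall n, f n <= g n) -> Defs.negligible g -> Defs.negligible f.
Proof.
move=> le hg c c0; near=> n; apply: le_trans (le n) _; near: n; exact: hg.
Unshelve. all: by end_near.
Qed.

Lemma efficient_fingerprint : is_efficient fingerprint.
Proof.
(* The largest iteration bound is the prime: [8 * (2 ^ k n) ^ 2] with [2 ^ k n <= 4 * n.+1 ^ 2]
   gives [128 * n.+1 ^ 4]. *)
pose Zf z := (128 * z.+1 ^ 4)%N.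
have pZ : poly_bounded Zf.
  exists 128%N => z; by rewrite /Zf leq_mul // leq_pexp2l.
have [c1 h1] := poly_bounded_comp (@cost_homo prog_fingerprint)
  (poly_bounded_cost prog_fingerprint) pZ.
have [c2 h2] := poly_bounded_add poly_bounded_id pZ.
exists prog_fingerprint, (c1 + c2)%N => n x.
have kZ : (2 ^ k n <= 4 * n.+1 ^ 2)%N.
  rewrite /k mulnC expnM -[4%N]/(2 ^ 2)%N -expnMn leq_exp2r //.
  exact: expn_half_width_leq.
have nm : (n.+1 ^ 4 <= (n + m n).+1 ^ 4)%N by rewrite leq_exp2r // ltnS leq_addr.
have n4 : (n.+1 ^ 2 <= n.+1 ^ 4)%N by rewrite leq_pexp2l.
have z4 : ((n + m n).+1 <= (n + m n).+1 ^ 4)%N by rewrite -{1}(expn1 _.+1) leq_pexp2l.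
have ltk := ltn_expl (k n) (ltnSn 1).
have pP : (p n <= Zf (n + m n))%N.
  apply: leq_trans (next_prime_leq (k n)) _.
  apply: leq_trans (_ : _ <= 8 * (4 * n.+1 ^ 2) ^ 2)%N _.
    by rewrite leq_mul2l leq_exp2r.
  rewrite expnMn -expnM mulnA /Zf leq_mul2l /=; exact: nm.
have [||||t0 [s [C [ex lt eC]]]] := @wp_fingerprint (Zf (n + m n)) n (m n) x.
- by rewrite /Zf; lia.
- by rewrite /Zf; lia.
- exact: pP.
- by rewrite /Zf -/(k n); lia.
exists t0, s, C, (k n).+1; split=> //.
- apply: leq_trans lt _; apply: leq_trans (h1 (n + m n)%N) _.
  by apply: poly_bounded_weaken; rewrite leq_addr.
- apply: leq_trans (_ : _ <= n + m n + Zf (n + m n))%N _; first by rewrite /Zf; lia.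
  apply: leq_trans (h2 (n + m n)%N) _.
  by apply: poly_bounded_weaken; rewrite leq_addl.
by rewrite eC; apply: prepares_hash_state.
Qed.
End Fingerprint.

Unset Implicit Arguments.
Set Strict Implicit.

Local Open Scope classical_set_scope.
Local Open Scope ring_scope.
Local Open Scope complex_scope.

Theorem corollary1p2 (R : realType) (k : nat -> R) (m : nat -> nat)
  (hk : forall n : nat, 0 <= k n <= n%:R)
  (hk_log : (n%:R - k n) / log2 (n%:R : R) @[n --> \oo] --> +oo)
  (hm_log : (m n)%:R / log2 (n%:R : R) @[n --> \oo] --> +oo) :
  exists phi : forall n : nat, n.-tuple bool -> 'cV[R[i]]_(2 ^ m n),
    [/\ is_quantum_hash phi,
        is_efficient phi
      & is_resilient k phi].
Proof.
exists (@fingerprint R m); have neg := negligible_max_overlap hm_log; split.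
- by exists (fun n => max_overlap (@fingerprint R m n)); split=> // n; split=> // x;
    apply: dotc_fingerprint.
- exact: efficient_fingerprint.
apply: negligible_le (negligible_add (negligible_powR2 hk_log) neg) => n.
exact/forgery_sup_le/dotc_fingerprint.
Qed.
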